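(* There exists a function $f \colon \mathbb{N} \to \mathbb{N} \times \mathbb{N}$ such that for every $K \in \mathbb{N}$, every graph $G$ with no $K$-fat $K_4^-$ minor is $f(K)$-quasi-isometric to a graph $H$ with no $K_4^-$ minor.
   Context: Graphs are simple and may be finite or infinite; $\mathbb{N}$ contains $0$. $K_4^-$ is the graph $K_4$ with one edge removed. $d_G$ denotes graph distance in $G$ (it is $\infty$ between different components); for sets of vertices (or subgraphs, via their vertex sets) it is the minimum distance between their elements. A $U_1$--$U_2$ path meets $U_1$ precisely in its first vertex and $U_2$ precisely in its last vertex. A model $(\mathcal{V},\mathcal{E})$ of a graph $X$ in a graph $G$ consists of a collection $\mathcal{V}$ of disjoint sets $V_x \subseteq V(G)$ ($x \in V(X)$) such that each $G[V_x]$ is connected (and non-empty), and a collection $\mathcal{E}$ of internally disjoint $V_{x_0}$--$V_{x_1}$ paths $E_e$, one for each edge $e = x_0x_1$ of $X$, where $E_e$ is disjoint from every $V_x$ with $x \neq x_0,x_1$. The model is $K$-fat if $d_G(Y,Z) \geq K$ for every two distinct $Y,Z \in \mathcal{V}\cup\mathcal{E}$ unless one of them is $E_e$ and the other is $V_x$ for some vertex $x$ incident with $e$ in $X$. $X$ is a ($K$-fat) minor of $G$ if $G$ contains a ($K$-fat) model of $X$. The $0$-fat minors are the usual minors. For $M \in \mathbb{R}_{\geq 1}$ and $A \in \mathbb{R}_{\geq 0}$, an $(M,A)$-quasi-isometry from a graph $G$ to a graph $H$ is a map $\varphi \colon V(G) \to V(H)$ such that $M^{-1} d_G(u,v) - A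 \leq d_H(\varphi(u),\varphi(v)) \leq M d_G(u,v) + A$ for all $u,v \in V(G)$, and for every $h \in V(H)$ there is $v \in V(G)$ with $d_H(h,\varphi(v)) \leq A$. $G$ is $(M,A)$-quasi-isometric to $H$ if there is an $(M,A)$-quasi-isometry from $G$ to $H$. *)

(* Defs.v *)
From mathcomp Require Import all_boot all_order all_algebra.
From mathcomp Require Import boolp classical_sets reals constructive_ereal ereal.

Set Implicit Arguments.
Unset Strict Implicit.
Unset Printing Implicit Defensive.

Import Order.TTheory GRing.Theory Num.Theory.
Local Open Scope classical_set_scope.
Local Open Scope ring_scope.

(* Possibly infinite simple graphs.  By the axioms of boolp, every type carries
   a choiceType structure (gen_eqMixin, gen_choiceMixin) and every Prop-valued
   relation is boolean, so neither choiceType nor rel restricts generality. *)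
Record graph : Type := Graph {
  vertex :> choiceType;
  adj : rel vertex;
  adj_sym : symmetric adj;
  adj_irr : irreflexive adj
}.

Arguments adj {g}.

Section Complete.
Variable n : nat.

Definition complete_adj : rel 'I_n := fun i j => i != j.

Lemma complete_sym : symmetric complete_adj.
Proof. by move=> i j; rewrite /complete_adj eq_sym. Qed.

Lemma complete_irr : irreflexive complete_adj.
Proof. by move=> i; rewrite /complete_adj eqxx. Qed.

Definition complete : graph := Graph complete_sym complete_irr.
End Complete.

Section DeleteEdge.
Variables (G : graph) (a b : G).

Definition del_edge_adj : rel G :=
  fun u v => adj u v && ((u, v) \notin [:: (a, b); (b, a)]).

Lemma del_edge_sym : symmetric del_edge_adj.
Proof.
move=> u v; rewrite /del_edge_adj adj_sym; congr (_ && ~~ _).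
by rewrite !inE !xpair_eqE orbC; congr (_ || _); rewrite andbC.
Qed.

Lemma del_edge_irr : irreflexive del_edge_adj.
Proof. by move=> u; rewrite /del_edge_adj adj_irr. Qed.

Definition del_edge : graph := Graph del_edge_sym del_edge_irr.
End DeleteEdge.

Definition K4minus : graph := @del_edge (complete 4) ord0 ord_max.

(* Infimum of the lengths of the walks from u to v; +oo if there is none. *)
Definition dist (R : realType) (G : graph) (u v : G) : \bar R :=
  ereal_inf [set ((size p)%:R)%:E | p in
               [set p : seq G | path adj u p && (last u p == v)]].

Definition set_dist (R : realType) (G : graph) (U W : set G) : \bar R :=
  ereal_inf [set dist R z.1 z.2 | z in [set z : G * G | U z.1 /\ W z.2]].

(* U is non-empty and the induced subgraph G[U] is connected. *)
Definition connected_set (G : graph) (U : set G) : Prop :=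
  U !=set0 /\
  forall u v, U u -> U v ->
    exists p : seq G, [/\ path adj u p, last u p = v & [set` p] `<=` U].

(* Paths are non-empty sequences of vertices, read from first to last. *)
Definition set_path (G : graph) (U W : set G) (p : seq G) : Prop :=
  if p is x :: q then
    [/\ path adj x q, uniq (x :: q),
        [set` x :: q] `&` U = [set x]
      & [set` x :: q] `&` W = [set last x q]]
  else False.

Definition inner (G : graph) (p : seq G) : seq G :=
  if p is x :: q then behead (belast x q) else [::].

(* The path of the edge xy of X is given in both orientations, E x y and its
   reverse E y x; values of E at non-adjacent pairs are irrelevant.  Two edges
   xy and zw of X are distinct iff [set x; y] <> [set z; w]. *)
Definition model (X G : graph) (V : X -> set G) (E : X -> X -> seq G) : Prop :=
  [/\ forall x, connected_set (V x),
      forall x y, x <> y -> V x `&` V y = set0,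
      forall x y, adj x y ->
        set_path (V x) (V y) (E x y) /\ E y x = rev (E x y),
      forall x y z w, adj x y -> adj z w -> [set x; y] <> [set z; w] ->
        [set` inner (E x y)] `&` [set` E z w] = set0
    & forall x y z, adj x y -> z <> x -> z <> y ->
        [set` E x y] `&` V z = set0].

Definition fat (R : realType) (K : nat) (X G : graph)
    (V : X -> set G) (E : X -> X -> seq G) : Prop :=
  [/\ forall x y, x <> y -> (K%:R%:E <= set_dist R (V x) (V y))%E,
      forall x y z w, adj x y -> adj z w -> [set x; y] <> [set z; w] ->
        (K%:R%:E <= set_dist R [set` E x y] [set` E z w])%E
    & forall x y z, adj x y -> z <> x -> z <> y ->
        (K%:R%:E <= set_dist R [set` E x y] (V z))%E].

Definition fat_minor (R : realType) (K : nat) (X G : graph) : Prop :=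
  exists (V : X -> set G) (E : X -> X -> seq G), model V E /\ fat R K V E.

Definition minor (X G : graph) : Prop :=
  exists (V : X -> set G) (E : X -> X -> seq G), model V E.

Definition quasi_isometry (R : realType) (M A : R) (G H : graph)
    (phi : G -> H) : Prop :=
  [/\ 1 <= M, 0 <= A,
      forall u v : G,
        ((M^-1)%:E * dist R u v - A%:E <= dist R (phi u) (phi v)
           <= M%:E * dist R u v + A%:E)%E
    & forall h : H, exists v : G, (dist R h (phi v) <= A%:E)%E].

Definition quasi_isometric (R : realType) (M A : R) (G H : graph) : Prop :=
  exists phi : G -> H, quasi_isometry M A phi.

(* Main.v *)
(* Root every component of G and consider the levels of the distance to the root.
   The frontier of a component C of {level >= n} is its set of vertices of level n.
   Three pairwise far points in a frontier would yield a fat theta between the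
   ball below and C, hence a fat K4-; so a frontier is either bounded or splits into
   two bounded clusters far apart.  Let H be the quotient of G by these bounded
   frontiers and clusters: G -> H is 1-Lipschitz with bounded fibres, so it is a
   quasi-isometry.  Two children of one component with wide frontiers would again
   give a fat theta (through both children and through the root), so at most one
   child of a component has a wide frontier.  It follows that any two vertices of H
   are separated by at most two edges, whereas a K4- minor contains three
   edge-disjoint paths between two vertices. *)
Require Import Defs.
From mathcomp Require Import all_boot all_order all_algebra.
From mathcomp Require Import boolp classical_sets reals constructive_ereal ereal.
From mathcomp Require Import generic_quotient zify.

Set Implicit Arguments.
Unset Strict Implicit.
Unset Printing Implicit Defensive.

Import Order.TTheory GRing.Theory Num.Theory.

(** * Walks inside a vertex set, bounded distance, and sets far apart *)

Section Walks.
Local Open Scope classical_set_scope.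
Variable G : graph.
Implicit Types (u v w x y z : G) (U W P : set G) (m n : nat).

(** An inductive form of the walks in [connected_set], with both ends required to lie in [U];
    [connP] translates. *)
Inductive conn U : G -> G -> Prop :=
| conn_refl u : U u -> conn U u u
| conn_step u v w : U u -> adj u v -> conn U v w -> conn U u w.

Lemma conn_start U u v : conn U u v -> U u.
Proof. by case. Qed.

Lemma conn_end U u v : conn U u v -> U v.
Proof. by elim. Qed.

Lemma conn_trans U u v w : conn U u v -> conn U v w -> conn U u w.
Proof.
by move=> uv; elim: uv w => // x y z Ux xy _ IH w /IH; exact: conn_step.
Qed.

Lemma conn_edge U u v : U u -> U v -> adj u v -> conn U u v.
Proof. by move=> Uu Uv uv; apply: (conn_step Uu uv); exact: conn_refl. Qed.

Lemma conn_sym U u v : conn U u v -> conn U v u.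
Proof.
elim=> [x|x y z Ux xy yz IH]; first exact: conn_refl.
apply: (conn_trans IH); apply: conn_edge => //; first exact: conn_start yz.
by rewrite adj_sym.
Qed.

Lemma conn_sub U W u v : U `<=` W -> conn U u v -> conn W u v.
Proof.
move=> UW; elim=> [x /UW|x y z /UW Wx xy _]; first exact: conn_refl.
exact: conn_step.
Qed.

Lemma conn_self U u v : conn U u v -> conn (conn U u) u v.
Proof.
suff H x : conn U u x -> conn U x v -> conn (conn U u) x v.
  by move=> uv; apply: H => //; apply: conn_refl; exact: conn_start uv.
move=> ux xv; elim: xv ux => {x v} [x Ux ux|x y z Ux xy yz IH ux].
  exact: conn_refl.
apply: (conn_step ux xy); apply: IH; apply: (conn_trans ux).
by apply: conn_edge => //; exact: conn_start yz.
Qed.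

Lemma connP U u v :
  conn U u v <-> exists p, [/\ path adj u p, last u p = v & [set` u :: p] `<=` U].
Proof.
split=> [|[p [+ + +]]].
  elim=> [x Ux|x y z Ux xy _ [p [yp lp pU]]].
    by exists [::]; split=> // w; rewrite /= inE => /eqP->.
  exists (y :: p); split=> //=; first by rewrite xy.
  by move=> w; rewrite /= inE => /predU1P[->//|]; exact: pU.
elim: p u => [|y p IH] u /=.
  by move=> _ -> pU; apply: conn_refl; apply: pU; rewrite /= inE.
case/andP=> uy yp lp pU; apply: (conn_step _ uy).
  by apply: pU; rewrite /= inE eqxx.
by apply: IH => // w wp; apply: pU; rewrite /= inE [_ \in _ :: _]wp orbT.
Qed.

Lemma connected_setP U :
  connected_set U <-> U !=set0 /\ forall u v, U u -> U v -> conn U u v.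
Proof.
split=> -[U0 HU]; split=> // u v Uu Uv.
  have [p [up lp pU]] := HU u v Uu Uv; apply/connP; exists p; split=> //.
  by move=> w; rewrite /= inE => /predU1P[->//|]; exact: pU.
have /connP[p [up lp pU]] := HU u v Uu Uv; exists p; split=> // w wp.
by apply: pU; rewrite /= inE [_ \in p]wp orbT.
Qed.

Lemma connected_star U x : U x -> (forall u, U u -> conn U x u) -> connected_set U.
Proof.
move=> Ux HU; apply/connected_setP; split=> [|u v /HU xu /HU xv]; first by exists x.
by apply: conn_trans xv; exact: conn_sym.
Qed.

Lemma conn_cross U (S : set G) u v : conn U u v -> S u -> ~ S v ->
  exists a b, [/\ U a, U b, adj a b, S a & ~ S b].
Proof.
elim=> [x _ //|x y z Ux xy yz IH Sx nSz].
have [Sy|nSy] := pselect (S y); first exact: IH.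
by exists x, y; split=> //; exact: conn_start yz.
Qed.

(** The walk is cut at its first vertex in [W], and [L] collects the vertices up to there. *)
Lemma conn_first_hit U W u v : conn U u v -> W v ->
  exists x (L : set G), [/\ L `<=` U, conn L u x & L `&` W = [set x]].
Proof.
elim=> {u v} [u Uu Wu|u v w Uu uv vw IH Ww].
  exists u, [set u]; split; [by move=> x ->|exact: conn_refl|].
  by apply/seteqP; split=> [x []|x ->].
have [Wu|nWu] := pselect (W u).
  exists u, [set u]; split; [by move=> x ->|exact: conn_refl|].
  by apply/seteqP; split=> [x []|x ->].
have [x [L [LU Lvx LW]]] := IH Ww; exists x, (u |` L); split.
- by move=> y [->|/LU].
- apply: (@conn_step _ _ v) => //; first by left.
  by apply: conn_sub Lvx => y; right.
- rewrite setIUl LW; apply/seteqP; split=> [y [[-> //]|//]|y ->]; last by right.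
Qed.

(** Distance at most [n], kept in [nat]; vertices in different components satisfy it for no [n],
    which replaces an infinite value. *)
Inductive dle : nat -> G -> G -> Prop :=
| dle_refl n u : dle n u u
| dle_step n u v w : adj u v -> dle n v w -> dle n.+1 u w.

Lemma dle_leq m n u v : m <= n -> dle m u v -> dle n u v.
Proof.
move=> mn uv; elim: uv n mn => [*|k x y z xy _ IH [//|n] kn].
  exact: dle_refl.
by apply: (dle_step xy); exact: IH.
Qed.

Lemma dle_trans m n u v w :
  dle m u v -> dle n v w -> dle (m + n) u w.
Proof.
move=> uv; elim: uv w => [k x y|k x y z xy _ IH w /IH]; last first.
  by rewrite addSn; exact: dle_step.
by apply: dle_leq; rewrite leq_addl.
Qed.

Lemma dle1 u v : adj u v -> dle 1 u v.
Proof. by move=> uv; apply: (dle_step uv); exact: dle_refl. Qed.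

Lemma dle_sym n u v : dle n u v -> dle n v u.
Proof.
elim=> [*|k x y z xy _ yz]; first exact: dle_refl.
by rewrite -addn1; apply: (dle_trans yz); apply: dle1; rewrite adj_sym.
Qed.

Lemma dle0 u v : dle 0 u v -> u = v.
Proof.
suff H n : dle n u v -> n = 0 -> u = v by move/H; exact.
by case.
Qed.

(** The numbers [i] and [j] count the steps before and after [w]. The bound on their sum later
    confines walks to neighbourhoods or to high levels. *)
Lemma dle_conn n u v : dle n u v ->
  conn [set w | exists i j, [/\ i + j <= n, dle i u w & dle j w v]] u v.
Proof.
elim=> {n u v} [n u|n u v w uv vw IH].
  by apply: conn_refl; exists 0, 0; split=> //; exact: dle_refl.
apply: (conn_step _ uv).
  by exists 0, n.+1; split=> //; [exact: dle_refl|exact: dle_step vw].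
apply: conn_sub IH => x [i [j [ijn vx xw]]]; exists i.+1, j; split=> //.
exact: dle_step vx.
Qed.

Lemma dle_split m n u v : dle (m + n) u v ->
  exists2 w, dle m u w & dle n w v.
Proof.
elim: m u v => [|m IH] u v; first by exists u; [exact: dle_refl|].
move E: (m.+1 + n) => k uv; case: uv E => [k' x _|k' x y z xy yz E].
  by exists x; exact: dle_refl.
have {}E : k' = m + n by lia.
subst k'; have [w yw wz] := IH _ _ yz.
by exists w => //; exact: dle_step yw.
Qed.

Lemma dleP n u v :
  dle n u v <-> exists p, [/\ path adj u p, last u p = v & size p <= n].
Proof.
split=> [|[p [+ + +]]].
  elim=> [k x|k x y z xy _ [p [yp lp pk]]]; first by exists [::].
  by exists (y :: p); split=> //=; rewrite xy.
elim: p u n => [|y p IH] u n /=; first by move=> _ -> _; exact: dle_refl.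
by case/andP=> uy yp lp; case: n => // n pn; apply: (dle_step uy); exact: IH.
Qed.

Definition nbhd U n : set G := [set w | exists2 u, U u & dle n u w].

Lemma sub_nbhd U n : U `<=` nbhd U n.
Proof. by move=> u Uu; exists u => //; exact: dle_refl. Qed.

Lemma nbhd_leq U m n : m <= n -> nbhd U m `<=` nbhd U n.
Proof. by move=> mn w [u Uu uw]; exists u => //; exact: dle_leq uw. Qed.

Lemma connected_nbhd U n : connected_set U -> connected_set (nbhd U n).
Proof.
move=> /connected_setP[[x Ux] HU]; apply: (@connected_star _ x); first exact: sub_nbhd.
move=> w [u Uu uw]; apply: (@conn_trans _ _ u).
  by apply: conn_sub (HU _ _ Ux Uu); exact: sub_nbhd.
apply: conn_sub (dle_conn uw) => z [i [j [ijn uz _]]].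
by exists u => //; apply: dle_leq uz; lia.
Qed.

Lemma connected_set1 x : connected_set [set x].
Proof. by apply: (@connected_star _ x) => // u ->; exact: conn_refl. Qed.

(** A lower bound on the distance phrased without an infimum, so that triangle inequalities become
    arithmetic in [nat]; [far_set_dist] passes to [set_dist]. *)
Definition far n U W := forall m u w, U u -> W w -> dle m u w -> n <= m.

Lemma far_sym n U W : far n U W -> far n W U.
Proof. by move=> H m u w Uu Ww /dle_sym; exact: H. Qed.

Lemma far_nbhd m n U W U' : far (m + n) U W -> U' `<=` nbhd U m -> far n U' W.
Proof.
move=> H U'U k u' w /U'U[u Uu uu'] Ww u'w.
by have := H _ _ _ Uu Ww (dle_trans uu' u'w); rewrite leq_add2l.
Qed.

Lemma far_leq m n U W : m <= n -> far n U W -> far m U W.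
Proof. by move=> mn H k u w Uu Ww /(H _ _ _ Uu Ww); exact: leq_trans. Qed.

Lemma far_disjoint n U W : 0 < n -> far n U W -> U `&` W = set0.
Proof.
move=> n0 H; apply/seteqP; split=> // x [Ux Wx].
by have := H 0 x x Ux Wx (dle_refl _ _); rewrite leqNgt n0.
Qed.

End Walks.

(** * Set-to-set paths: existence, reversal, avoiding a neighbourhood *)

Section SetPaths.
Local Open Scope classical_set_scope.
Variable G : graph.
Implicit Types (u v w x y z : G) (U W P : set G) (m n : nat) (p q : seq G).

Lemma set_rev p : [set` rev p] = [set` p].
Proof. by apply/seteqP; split=> w /=; rewrite mem_rev. Qed.

Lemma set_path_exists U W P u v : conn P u v -> U u -> W v ->
  exists2 p, set_path U W p & [set` p] `<=` P.
Proof.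
(* A shortest walk from U to W inside P is a U--W path. *)
move=> uv Uu Wv.
pose Q n := exists x q, [/\ U x, path adj x q, W (last x q),
  [set` x :: q] `<=` P & size q <= n].
have exQ : exists n, `[< Q n >].
  have /connP[p [up lp pP]] := uv; exists (size p); apply/asboolP.
  by exists u, p; rewrite lp.
case: (ex_minnP exQ) => n /asboolP[x [q0 [Ux + + + sq0]]] minn.
case/shortenP => q xq uq /(_ _)qq0 Wq q0P.
have qP : [set` x :: q] `<=` P.
  move=> w; rewrite /= inE => /predU1P[->|/qq0 wq]; apply: q0P => /=.
    by rewrite inE eqxx.
  by rewrite inE wq orbT.
have sq : size q <= n.
  by apply: leq_trans sq0; apply: uniq_leq_size => //; case/andP: uq.
have minq y p : U y -> path adj y p -> W (last y p) ->
    [set` y :: p] `<=` P -> n <= size p.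
  by move=> *; apply: minn; apply/asboolP; exists y, p.
exists (x :: q) => //; split=> //; apply/seteqP; split=> w /=.
- case; rewrite inE => /predU1P[->//|wq Uw].
  case/splitPr: wq sq qP xq Wq {uq qq0} => p1 p2 sq qP.
  rewrite cat_path /= last_cat => /and3P[_ _ wp2] Wp2.
  rewrite size_cat /= in sq; have H := minq w p2 Uw wp2 Wp2; exfalso.
  have /H : [set` w :: p2] `<=` P; last first.
    by move/(leq_trans sq); rewrite addnS ltnNge leq_addl.
  by move=> z zp; apply: qP; rewrite /= inE mem_cat [_ \in w :: p2]zp !orbT.
- by move->; rewrite mem_head.
(* The part up to a vertex of [W] already has minimal length, so nothing follows it. *)
- case=> /splitPl wq Ww; case: wq sq qP xq Ww {uq qq0 Wq} => p1 p2 lp1.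
  rewrite size_cat => sq qP; rewrite cat_path => /andP[xp1 _] Ww.
  have := minq x p1 Ux xp1; rewrite lp1 => /(_ Ww) H.
  have /H sp1 : [set` x :: p1] `<=` P.
    by move=> z zp; apply: qP; rewrite /= -cat_cons mem_cat [_ \in x :: p1]zp.
  have /nilP -> : nilp p2
    by rewrite /nilp -leqn0 -(leq_add2l (size p1)) addn0 (leq_trans sq).
  by rewrite cats0.
- by move->; rewrite mem_last.
Qed.

Lemma set_path_rev U W p : set_path U W p -> set_path W U (rev p).
Proof.
case: p => //= x q; set r := x :: q => -[xq uq pU pW].
have [y [s rE]] : exists y s, rev r = y :: s.
  by case E: (rev r) => [|y s]; [move/eqP: E; rewrite -size_eq0 size_rev|exists y, s].
have yE : y = last x q.
  suff : head x (rev r) = last x q by rewrite rE.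
  by rewrite /r; case/lastP: (q) => // q' z; rewrite last_rcons -rcons_cons rev_rcons.
have xE : x = last y s.
  rewrite -[last y s]/(last x (y :: s)) -rE /r rev_cons last_rcons //.
rewrite rE /set_path; split.
- have : sorted adj r by [].
  rewrite -rev_sorted rE /=; apply: sub_path => a b.
  by rewrite adj_sym.
- by rewrite -rE rev_uniq.
- by rewrite -rE set_rev pW yE.
- by rewrite -rE set_rev pU -xE.
Qed.

(** Only the first vertex of the path lies in [nbhd U n.+1]. Were it in [nbhd U n], the second
    vertex would still be in [nbhd U n.+1]; a second vertex exists because the path must end in
    [W]. *)
Lemma set_path_avoids_nbhd n U W p :
  set_path (nbhd U n.+1) W p -> nbhd U n.+1 `&` W = set0 ->
  [set` p] `&` nbhd U n = set0.
Proof.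
case: p => //= x q [xq uq pU pW] UW.
apply/seteqP; split=> // w [wp Uw].
have /= wx : [set x] w by rewrite -pU; split=> //; exact: nbhd_leq Uw.
subst w; case: q xq uq pU pW wp => [|y q] xq uq pU pW _.
  have : [set last x [::]] x by [].
  rewrite -pW => -[_ Wx]; have : set0 x by rewrite -UW; split=> //; exact: nbhd_leq Uw.
  by [].
case/andP: xq => xy _; have : [set x] y.
  rewrite -pU; split; first by rewrite /= !inE eqxx orbT.
  case: Uw => u Uu ux; exists u => //.
  by rewrite -addn1; apply: (dle_trans ux); exact: dle1.
by move=> yx; move: xy; rewrite yx adj_irr.
Qed.

End SetPaths.

(** * From far apart sets and paths to a fat model of K4- *)

Lemma far_set_dist (R : realType) (G : graph) K (U W : set G) :
  far K U W -> (K%:R%:E <= set_dist R U W)%E.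
Proof.
move=> H; apply: le_ereal_inf_tmp => _ [[u w] /= [Uu Ww] <-].
apply: le_ereal_inf_tmp => _ [p /= /andP[up /eqP lp] <-].
rewrite lee_fin ler_nat; apply: (H _ u w) => //.
by apply/dleP; exists p.
Qed.

Section FatK4minus.
Local Open Scope classical_set_scope.
Variable G : graph.

Lemma adj_K4minus (x y : K4minus) :
  adj x y = (val x != val y) && ((val x, val y) \notin [:: (0, 3); (3, 0)]).
Proof. by case: x y => [[|[|[|[|//]]]] ?] [[|[|[|[|//]]]] ?]. Qed.

(** Vertices 0 and 3 are the non-adjacent pair, 1 and 2 have degree three. The opposite orientation
    of an edge is the reversed path, and non-edges get a default. *)
Definition K4minus_paths (p10 p20 p13 p23 p12 : seq G) (x y : K4minus) : seq G :=
  match val x, val y with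
  | 1, 0 => p10 | 0, 1 => rev p10
  | 2, 0 => p20 | 0, 2 => rev p20
  | 1, 3 => p13 | 3, 1 => rev p13
  | 2, 3 => p23 | 3, 2 => rev p23
  | 1, 2 => p12 | 2, 1 => rev p12
  | _, _ => [::]
  end.

Lemma fat_K4minus (R : realType) (K : nat) (V0 V1 V2 V3 : set G)
    (p10 p20 p13 p23 p12 : seq G) : 0 < K ->
  connected_set V0 -> connected_set V1 -> connected_set V2 -> connected_set V3 ->
  set_path V1 V0 p10 -> set_path V2 V0 p20 -> set_path V1 V3 p13 ->
  set_path V2 V3 p23 -> set_path V1 V2 p12 ->
  far K V0 V1 -> far K V0 V2 -> far K V0 V3 ->
  far K V1 V2 -> far K V1 V3 -> far K V2 V3 ->
  far K [set` p10] V2 -> far K [set` p10] V3 ->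
  far K [set` p20] V1 -> far K [set` p20] V3 ->
  far K [set` p13] V0 -> far K [set` p13] V2 ->
  far K [set` p23] V0 -> far K [set` p23] V1 ->
  far K [set` p12] V0 -> far K [set` p12] V3 ->
  far K [set` p10] [set` p20] -> far K [set` p10] [set` p13] ->
  far K [set` p10] [set` p23] -> far K [set` p10] [set` p12] ->
  far K [set` p20] [set` p13] -> far K [set` p20] [set` p23] ->
  far K [set` p20] [set` p12] -> far K [set` p13] [set` p23] ->
  far K [set` p13] [set` p12] -> far K [set` p23] [set` p12] ->
  fat_minor R K K4minus G.
Proof.
move=> K0 C0 C1 C2 C3 S10 S20 S13 S23 S12.
(* These are 6 pairs of branch sets, 10 pairs of an edge and a vertex off it, and 10 pairs of
   edges. *)
do 26!move=> ?.
pose V (x : K4minus) := nth V0 [:: V0; V1; V2; V3] (val x).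
pose E := K4minus_paths p10 p20 p13 p23 p12.
have VV x y : x <> y -> far K (V x) (V y).
  case: x y => [[|[|[|[|//]]]] hx] [[|[|[|[|//]]]] hy] // xy;
    by [case: xy; exact/val_inj|apply: far_sym].
have EV x y z : adj x y -> z <> x -> z <> y -> far K [set` E x y] (V z).
  rewrite adj_K4minus; case: x y => [[|[|[|[|//]]]] hx] [[|[|[|[|//]]]] hy] //= _;
  case: z => [[|[|[|[|//]]]] hz] zx zy;
    by [case: zx; exact/val_inj|case: zy; exact/val_inj
       |rewrite /E /K4minus_paths /= ?set_rev].
have EE x y z w : adj x y -> adj z w -> [set x; y] <> [set z; w] ->
    far K [set` E x y] [set` E z w].
  move=> xy zw ne.
  have {ne} : ~~ ((val x == val z) && (val y == val w) ||
                  (val x == val w) && (val y == val z)).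
    apply/negP => /orP[]/andP[/eqP/val_inj xz /eqP/val_inj yw]; apply: ne.
      by rewrite xz yw.
    by rewrite xz yw setUC.
  move: xy zw; rewrite !adj_K4minus.
  case: x y => [[|[|[|[|//]]]] hx] [[|[|[|[|//]]]] hy] //= _;
  case: z w => [[|[|[|[|//]]]] hz] [[|[|[|[|//]]]] hw] //= _ _;
  rewrite /E /K4minus_paths /= ?set_rev;
  by [|apply: far_sym].
exists V, E; split; last first.
  by split=> *; apply: far_set_dist; [exact: VV|exact: EE|exact: EV].
split.
- by case=> [[|[|[|[|//]]]] ?].
- by move=> x y /VV; exact: far_disjoint.
- move=> x y; rewrite adj_K4minus.
  case: x y => [[|[|[|[|//]]]] hx] [[|[|[|[|//]]]] hy] //= _;
  rewrite /E /K4minus_paths /V /= ?revK; split=> //; exact: set_path_rev.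
- move=> x y z w xy zw ne.
  have /(far_disjoint K0) EE0 := EE _ _ _ _ xy zw ne.
  apply/seteqP; split=> // u [ui uE]; rewrite -EE0; split=> //.
  case: (E x y) ui => // a s /= ui; rewrite inE; apply/orP; right.
  case: s ui => // b s /= ui; exact: mem_belast.
- by move=> x y z xy zx zy; apply: (far_disjoint K0); exact: EV.
Qed.

End FatK4minus.

(** * Turning a theta with far apart strands into a fat K4- *)

Section Theta.
Local Open Scope classical_set_scope.
Variable G : graph.
Implicit Types (A B P Q U W : set G).

Definition joins A B P := exists a b, [/\ A a, B b & conn P a b].

(** The strands of a theta may approach or even share vertices inside its ends, but not
    elsewhere. *)
Definition near_only_in U (k : nat) P Q := forall m u v, P u -> Q v -> dle m u v ->
  m < k -> U u /\ U v.

Lemma connected_set_path U W p : set_path U W p -> connected_set [set` p].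
Proof.
case: p => // x q [xq _ _ _]; apply: (@connected_star _ _ x) => [|u /splitPl].
  by rewrite /= mem_head.
move=> E; case: E xq => q1 q2 lq1; rewrite cat_path => /andP[xq1 _].
apply/connP; exists q1; split=> // w /= wq.
by rewrite -cat_cons mem_cat [_ \in x :: q1]wq.
Qed.

Lemma set_path_ends U W p : set_path U W p ->
  exists x y, [/\ U x, W y, conn [set` p] x y,
    [set` p] `&` U = [set x] & [set` p] `&` W = [set y]].
Proof.
case: p => // x q [xq _ pU pW]; exists x, (last x q); split=> //.
- by have : [set x] x by []; rewrite -pU => -[].
- by have : [set last x q] (last x q) by []; rewrite -pW => -[].
- by apply/connP; exists q; split.
Qed.

(** One set avoiding [U] suffices, since a close pair would have both its points in [U]. *)
Lemma far_near_only_in U k P Q P' Q' : near_only_in U k P Q ->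
  P' `<=` P -> Q' `<=` Q -> P' `&` U = set0 -> far k P' Q'.
Proof.
move=> H P'P Q'Q P'U m u v P'u Q'v uv; rewrite leqNgt; apply/negP => mk.
have [Uu _] := H m u v (P'P _ P'u) (Q'Q _ Q'v) uv mk.
by have : set0 u by rewrite -P'U.
Qed.

(** The two [n.+1]-neighbourhoods are disjoint, as their radii sum to less than [N]; a path that
    stops at them stays outside both [n]-neighbourhoods. *)
Lemma join_path n N A B P : far N A B -> n.+1.*2 < N -> joins A B P ->
  exists2 p, set_path (nbhd A n.+1) (nbhd B n.+1) p &
    [/\ [set` p] `<=` P, [set` p] `&` nbhd A n = set0
      & [set` p] `&` nbhd B n = set0].
Proof.
move=> AB nN [a [b [Aa Bb ab]]].
have ABn : nbhd A n.+1 `&` nbhd B n.+1 = set0.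
  apply/seteqP; split=> // w [[u Au uw] [v Bv vw]].
  have := AB _ _ _ Au Bv (dle_trans uw (dle_sym vw)); lia.
have [p Sp pP] := set_path_exists ab (@sub_nbhd _ _ n.+1 _ Aa)
  (@sub_nbhd _ _ n.+1 _ Bb).
exists p => //; split=> //; first exact: set_path_avoids_nbhd ABn.
rewrite -(set_rev p); apply: set_path_avoids_nbhd (set_path_rev Sp) _.
by rewrite setIC.
Qed.

Lemma leg_path n k A U : U `&` nbhd A n = set0 -> U `&` nbhd A (n + k) !=set0 ->
  exists2 p, set_path (nbhd A n) U p &
    [set` p] `<=` nbhd A (n + k) /\ [set` p] `<=` nbhd U k.
Proof.
move=> UA [x [Ux [a Aa ax]]].
have [a' aa' a'x] := dle_split ax.
have Aa' : nbhd A n a' by exists a.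
have [p Sp pP] := set_path_exists (dle_conn a'x) Aa' Ux.
exists p => //; split=> w /pP[i [j [ijk a'w wx]]].
  by exists a => //; apply: dle_leq (dle_trans aa' a'w); lia.
exists x => //; apply: dle_sym; apply: dle_leq wx; lia.
Qed.

Lemma far_nbhd2 i j n U W U' W' : far (i + (j + n)) U W ->
  U' `<=` nbhd U i -> W' `<=` nbhd W j -> far n U' W'.
Proof.
move=> UW U'U W'W; apply: far_sym; apply: far_nbhd W'W; apply: far_sym.
exact: far_nbhd U'U.
Qed.

(** The ends [A] and [B], enlarged by 1, become the degree-three vertices; the middle parts of [P1]
    and [P2] become the degree-two vertices, joined to the ends by short legs; [P3] yields the fifth
    edge. A leg lies within [K] of its strand and within [1 + K] of its end, so strands [3 * K]
    apart and ends [3 * K + 2] apart keep any two legs [K] apart. *)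
Lemma theta_fat_K4minus (R : realType) (K : nat) A B P1 P2 P3 : 0 < K ->
  connected_set A -> connected_set B -> far (3 * K + 2) A B ->
  joins A B P1 -> joins A B P2 -> joins A B P3 ->
  near_only_in (A `|` B) (3 * K) P1 P2 -> near_only_in (A `|` B) (3 * K) P1 P3 ->
  near_only_in (A `|` B) (3 * K) P2 P3 -> fat_minor R K K4minus G.
Proof.
move=> K0 cA cB AB J1 J2 J3 N12 N13 N23.
have [p3 S3 [p3P p3A p3B]] : exists2 p, set_path (nbhd A 1) (nbhd B 1) p &
    [/\ [set` p] `<=` P3, [set` p] `&` nbhd A 0 = set0
      & [set` p] `&` nbhd B 0 = set0].
  by apply: (join_path AB) => //; lia.
have legs P : joins A B P -> exists p pA pB : seq G, [/\ set_path (nbhd A 1) [set` p] pA,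
    set_path (nbhd B 1) [set` p] pB & [/\ connected_set [set` p], [set` p] `<=` P,
    [set` p] `&` nbhd A K = set0, [set` p] `&` nbhd B K = set0 &
    [/\ [set` pA] `<=` nbhd A (1 + K), [set` pA] `<=` nbhd [set` p] K,
        [set` pB] `<=` nbhd B (1 + K) & [set` pB] `<=` nbhd [set` p] K]]].
  move=> J.
  have [|p Sp [pP pA pB]] := join_path (n := K) AB _ J; first by lia.
  have [x [y [Ax By _ px py]]] := set_path_ends Sp.
  have [||qA SA [qA1 qA2]] := @leg_path 1 K A [set` p].
  - apply/seteqP; split=> // w [wp wA]; rewrite -pA; split=> //.
    exact: nbhd_leq wA.
  - by exists x; rewrite add1n px.
  have [||qB SB [qB1 qB2]] := @leg_path 1 K B [set` p].
  - apply/seteqP; split=> // w [wp wB]; rewrite -pB; split=> //.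
    exact: nbhd_leq wB.
  - by exists y; rewrite add1n py.
  by exists p, qA, qB; split=> //; split=> //; exact: connected_set_path Sp.
have [q1 [a1 [b1 [SA1 SB1 [cq1 q1P q1A q1B [a1A a1q b1B b1q]]]]]] := legs _ J1.
have [q2 [a2 [b2 [SA2 SB2 [cq2 q2P q2A q2B [a2A a2q b2B b2q]]]]]] := legs _ J2.
have avoid (q : seq G) n : [set` q] `&` nbhd A n = set0 -> [set` q] `&` nbhd B n = set0 ->
    [set` q] `&` (A `|` B) = set0.
  move=> qA qB; apply/seteqP; split=> // w [wq [wA|wB]].
    by rewrite -qA; split=> //; exact: sub_nbhd.
  by rewrite -qB; split=> //; exact: sub_nbhd.
have F12 := far_near_only_in N12 q1P q2P (avoid _ _ q1A q1B).
have F13 := far_near_only_in N13 q1P p3P (avoid _ _ q1A q1B).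
have F23 := far_near_only_in N23 q2P p3P (avoid _ _ q2A q2B).
have far1 n U W U' : far (n + K) U W -> U' `<=` nbhd U n -> far K U' W.
  exact: far_nbhd.
(* Distance at least [K + 1] from [U] leaves distance at least [K] from its 1-neighbourhood. *)
have avoid_far (q : seq G) U : [set` q] `&` nbhd U K = set0 -> far K [set` q] (nbhd U 1).
  move=> qU m u w uq [x Ux xw] uw; rewrite leqNgt; apply/negP => mK.
  have : set0 u by rewrite -qU; split=> //; exists x => //;
    apply: dle_leq (dle_trans xw (dle_sym uw)); lia.
  by [].
have sub U n : U `<=` nbhd U n by exact: sub_nbhd.
have weak i j U W U' W' : far (3 * K) U W -> i + j <= 2 * K ->
    U' `<=` nbhd U i -> W' `<=` nbhd W j -> far K U' W'.
  by move=> UW ij; apply: far_nbhd2; apply: far_leq UW; lia.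
have weakAB i j U' W' : i + j <= 2 * K + 2 ->
    U' `<=` nbhd A i -> W' `<=` nbhd B j -> far K U' W'.
  by move=> ij; apply: far_nbhd2; apply: far_leq AB; lia.
apply: (@fat_K4minus G R K [set` q1] (nbhd A 1) (nbhd B 1) [set` q2]
          a1 b1 a2 b2 p3) => //; try exact: connected_nbhd; try exact: avoid_far.
- by apply: weak F12 _ (sub _ 0) (sub _ 0).
- by apply: (weakAB 1 1) => //; lia.
- by apply: far_sym; exact: avoid_far.
- by apply: far_sym; exact: avoid_far.
- by apply: weakAB a1A (fun _ => id); lia.
- by apply: weak F12 _ a1q (sub _ 0); lia.
- by apply: far_sym; apply: weakAB (fun _ => id) b1B; lia.
- by apply: weak F12 _ b1q (sub _ 0); lia.
- by apply: far_sym; apply: weak F12 _ (sub _ 0) a2q; lia.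
- by apply: weakAB a2A (fun _ => id); lia.
- by apply: far_sym; apply: weak F12 _ (sub _ 0) b2q; lia.
- by apply: far_sym; apply: weakAB (fun _ => id) b2B; lia.
- by apply: far_sym; apply: weak F13 _ (sub _ 0) (sub _ 0); lia.
- by apply: far_sym; apply: weak F23 _ (sub _ 0) (sub _ 0); lia.
- by apply: weakAB a1A b1B; lia.
- by apply: weak F12 _ a1q a2q; lia.
- by apply: weakAB a1A b2B; lia.
- by apply: weak F13 _ a1q (sub _ 0); lia.
- by apply: far_sym; apply: weakAB a2A b1B; lia.
- by apply: weak F12 _ b1q b2q; lia.
- by apply: weak F13 _ b1q (sub _ 0); lia.
- by apply: weakAB a2A b2B; lia.
- by apply: weak F23 _ a2q (sub _ 0); lia.
- by apply: weak F23 _ b2q (sub _ 0); lia.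
Qed.

End Theta.

(** * Distance levels and the components above a level *)

Section Levels.
Local Open Scope classical_set_scope.
Variable G : graph.
Implicit Types (u v w x y z : G) (U W : set G) (m n : nat).

(** One root per component of [G]: the component is non-empty, so [xget] never falls back on [u] and
    its choice depends on the component only. *)
Definition basept u : G := xget u (conn setT u).

Lemma conn_basept u : conn setT u (basept u).
Proof. by apply: (@xgetPex _ u (conn setT u)); exists u; exact: conn_refl. Qed.

Lemma basept_conn u v : conn setT u v -> basept u = basept v.
Proof.
move=> uv; have E : conn setT u = conn setT v.
  apply/funext => w; apply/propext; split; apply: conn_trans => //.
  exact: conn_sym.
rewrite /basept E; have vv : conn setT v v by exact: conn_refl.
by rewrite /xget; case: pselect => // -[]; exists v; exact/asboolP.
Qed.

Lemma basept_dle n u v : dle n u v -> basept u = basept v.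
Proof. by move=> /dle_conn/(conn_sub (@subsetT _ _)); exact: basept_conn. Qed.

Lemma exists_dle_basept u : exists n, `[< dle n (basept u) u >].
Proof.
have /conn_sym/connP[p [rp lp _]] := conn_basept u.
by exists (size p); apply/asboolP/dleP; exists p.
Qed.

Definition lev u : nat := ex_minn (exists_dle_basept u).

Lemma dle_lev u : dle (lev u) (basept u) u.
Proof. by rewrite /lev; case: ex_minnP => n /asboolP. Qed.

Lemma lev_min n u : dle n (basept u) u -> lev u <= n.
Proof.
by move=> h; rewrite /lev; case: ex_minnP => m _; apply; exact/asboolP.
Qed.

Lemma basept_idem u : basept (basept u) = basept u.
Proof. exact: basept_dle (dle_lev u). Qed.

Lemma lev_basept u : lev (basept u) = 0.
Proof.
by apply/eqP; rewrite -leqn0; apply: lev_min; rewrite basept_idem; exact: dle_refl.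
Qed.

Lemma lev_dle n u v : dle n u v -> lev v <= lev u + n.
Proof.
move=> uv; apply: lev_min; rewrite -(basept_dle uv).
exact: dle_trans (dle_lev u) uv.
Qed.

Lemma lev_adj u v : adj u v -> lev v <= (lev u).+1.
Proof. by move/dle1/lev_dle; rewrite addn1. Qed.

Lemma lev_pred n u : lev u = n.+1 -> exists2 v, adj v u & lev v = n.
Proof.
move=> un; have := dle_lev u; rewrite un -addn1 => /dle_split[v rv vu].
have rE : basept u = basept v by rewrite (basept_dle vu).
have vn : lev v <= n by apply: lev_min; rewrite -rE.
have uv := lev_dle vu; exists v; last by lia.
move E : 1 vu => k vu; case: vu E un uv vn {rv rE} => [*|k' x y z xy yz [kE]]; first lia.
by subst k'; rewrite -(dle0 yz).
Qed.

Definition up n := conn [set w | n <= lev w].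

Lemma up_leq m n u v : m <= n -> up n u v -> up m u v.
Proof. by move=> mn; apply: conn_sub => w; exact: leq_trans. Qed.

Lemma up_adj n u v : n <= lev u -> n <= lev v -> adj u v -> up n u v.
Proof. exact: conn_edge. Qed.

(** The walk climbs one level at a time. It is recorded as a set in which the level of a point
    bounds its distance to [u]. *)
Lemma geodesic_basept u :
  conn [set z | lev z <= lev u /\ dle (lev u - lev z) z u] (basept u) u.
Proof.
move E: (lev u) => n; elim: n u E => [|n IH] u un.
  have := dle_lev u; rewrite un => /dle0 ->; apply: conn_refl; rewrite /= un.
  by split=> //; exact: dle_refl.
have [v vu vn] := lev_pred un.
rewrite -(basept_dle (dle1 vu)).
apply: (@conn_trans _ _ _ v).
  apply: conn_sub (IH v vn) => z /= [zn zv]; split; first by lia.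
  by apply: dle_leq (dle_trans zv (dle1 vu)); lia.
apply: conn_edge => //=; split; rewrite ?un ?vn //.
  by apply: dle_leq (dle1 vu); lia.
by rewrite subnn; exact: dle_refl.
Qed.

Lemma ancestor m u : m <= lev u ->
  exists w, [/\ lev w = m, dle (lev u - m) w u & up m w u].
Proof.
move E: (lev u - m) => n; elim: n u E => [|n IH] u un mu.
  exists u; split; [lia|exact: dle_refl|exact: conn_refl].
have [v vu vn] : exists2 v, adj v u & lev v = (lev u).-1 by apply: lev_pred; lia.
have [||w [wm wv upw]] := IH v; try lia.
exists w; split=> //; first by rewrite -addn1; apply: (dle_trans wv); exact: dle1.
by apply: (conn_trans upw); apply: up_adj => //; lia.
Qed.

(** A walk of length [m] descends at most [m] levels, hence stays above level [n]. *)
Lemma up_near n m u v : dle m u v -> n + m < lev u -> up n.+1 u v.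
Proof.
move=> uv h; apply: conn_sub (dle_conn uv) => w [i [j [ijm uw _]]] /=.
have := lev_dle (dle_sym uw); lia.
Qed.

End Levels.

(** * Frontiers: width bounds, the equivalence of clusters, and small cuts *)

Definition cluster_radius K := 12 * K + 4.
(** This is [2 * r + (3 * K + 2) + 2] for the radius [r] in [unique_split_child_aligned]: vertices
    farther apart than this have parents whose [r]-balls are [3 * K + 2] apart. *)
Definition split_gap K := 4 * cluster_radius K + 15 * K + 6.
(** If [x] and [y] are farther apart than this, a point within [cluster_radius K] of [x] and one
    within it of [y] are more than [split_gap K + 2] apart; the 2 pays for one step to a
    neighbouring level at each end. *)
Definition class_diameter K := split_gap K + 2 * cluster_radius K + 2.

(* S has at most two boundary edges up to E: among any three, two coincide. *)
Definition small_cut (G : graph) (E : G -> G -> Prop) (S : set G) :=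
  forall a1 b1 a2 b2 a3 b3 : G, adj a1 b1 -> adj a2 b2 -> adj a3 b3 ->
  S a1 -> S a2 -> S a3 -> ~ S b1 -> ~ S b2 -> ~ S b3 ->
  [\/ E a1 a2 /\ E b1 b2, E a1 a3 /\ E b1 b3 | E a2 a3 /\ E b2 b3].

Section Frontiers.
Local Open Scope classical_set_scope.
Variables (R : realType) (G : graph) (K : nat).
Hypotheses (K0 : 0 < K) (noK : ~ fat_minor R K K4minus G).
Implicit Types (u v w x y z : G) (m n : nat).

Local Notation D := (cluster_radius K).
Local Notation T2 := (split_gap K).
Local Notation T := (class_diameter K).

Lemma up_refl n u : n <= lev u -> up n u u.
Proof. exact: conn_refl. Qed.

Lemma up_sym n u v : up n u v -> up n v u.
Proof. exact: conn_sym. Qed.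

Lemma up_trans n u v w : up n u v -> up n v w -> up n u w.
Proof. exact: conn_trans. Qed.

Lemma up_basept n u v : up n u v -> basept u = basept v.
Proof. by move/(conn_sub (@subsetT _ _)); exact: basept_conn. Qed.

(* Three far apart points of a frontier would give a fat theta between a ball
   around the basept and the component above. *)
Lemma frontier_pigeonhole n x1 x2 x3 : lev x1 = n -> lev x2 = n -> lev x3 = n ->
  up n x1 x2 -> up n x1 x3 -> [\/ dle D x1 x2, dle D x1 x3 | dle D x2 x3].
Proof.
move=> l1 l2 l3 up12 up13; apply: contrapT => nfar.
have n12 : ~ dle D x1 x2 by move=> h; apply: nfar; constructor 1.
have n13 : ~ dle D x1 x3 by move=> h; apply: nfar; constructor 2.
have n23 : ~ dle D x2 x3 by move=> h; apply: nfar; constructor 3.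
pose t := 3 * K + 2.
(* At a level below [t], a detour through the basept has length at most [6 * K + 2]. *)
have [nt|tn] := ltnP n t.
  apply: n12; have := dle_lev x1; have := dle_lev x2.
  rewrite l1 l2 (up_basept up12) => r2 /dle_sym r1.
  by apply: dle_leq (dle_trans r1 r2); rewrite /cluster_radius; lia.
pose A := [set w | basept w = basept x1 /\ lev w <= n - t].
pose B := [set w | up n x1 w].
pose P x := [set z | lev z <= lev x /\ dle (lev x - lev z) z x].
have rA x : up n x1 x -> A (basept x).
  by move=> upx; split; rewrite /= ?lev_basept // basept_idem (up_basept upx).
have cA : connected_set A.
  apply: (@connected_star _ _ (basept x1)) => [|u [ru lu]].
    by apply: rA; apply: conn_refl; rewrite /= l1.
  rewrite -ru; apply: conn_sub (geodesic_basept u) => z [zu zd]; split.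
    by rewrite (basept_dle zd).
  exact: leq_trans lu.
have cB : connected_set B.
  have ux : up n x1 x1 by apply: conn_refl; rewrite /= l1.
  by apply: (@connected_star _ _ x1) => // u; exact: conn_self.
have J x : lev x = n -> up n x1 x -> joins A B (P x).
  move=> lx upx; exists (basept x), x; split=> //; first exact: rA.
  exact: geodesic_basept.
have N x y : lev x = n -> lev y = n -> up n x1 x -> up n x1 y -> ~ dle D x y ->
    near_only_in (A `|` B) (3 * K) (P x) (P y).
  move=> lx ly ux uy nxy m u v [ul ud] [vl vd] uv mK.
  have inA z z' : up n x1 z' -> dle (lev z' - lev z) z z' -> ~ A z -> n - t < lev z.
    move=> uz' zz' nA; rewrite ltnNge; apply/negP => zn; apply: nA; split=> //.
    by rewrite (basept_dle zz') (up_basept uz').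
  have lu := lev_dle uv; have lv := lev_dle (dle_sym uv).
  (* If one of [u], [v] is at most [3 * K + 1] below level [n], the other is at most [6 * K] below;
     with their distance of at most [3 * K - 1] this sums to [12 * K]. *)
  have d_uv : n - t < lev u \/ n - t < lev v -> dle D x y.
    move=> uvn; apply: dle_leq (dle_trans (dle_sym ud) (dle_trans uv vd)).
    rewrite /cluster_radius; lia.
  split; apply: contrapT => /not_orP[nA _]; apply/nxy/d_uv; [left|right].
    exact: inA ux ud nA.
  exact: inA uy vd nA.
have far_AB : far (3 * K + 2) A B.
  move=> m u w [_ lu] /conn_end/= nw /lev_dle; lia.
have u11 : up n x1 x1 by apply: conn_refl; rewrite /= l1.
apply: noK; apply: (theta_fat_K4minus R K0 cA cB far_AB (J x1 l1 u11)
  (J x2 l2 up12) (J x3 l3 up13)); exact: N.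
Qed.

Lemma frontier_near n x y u : lev x = n -> lev y = n -> lev u = n ->
  up n x y -> up n x u -> ~ dle D x y -> dle D x u \/ dle D y u.
Proof.
by move=> lx ly lu uxy uxu nxy; case: (frontier_pigeonhole lx ly lu uxy uxu); auto.
Qed.

(** Descend from [u] to the frontier in at most [m] steps and apply the dichotomy there. *)
Lemma near_frontier_point n m x y u : lev x = n -> lev y = n -> up n x y ->
  ~ dle D x y -> up n x u -> lev u <= n + m -> dle (D + m) x u \/ dle (D + m) y u.
Proof.
move=> lx ly uxy nxy uxu lu.
have nu : n <= lev u := conn_end uxu.
have [w [lw wu upw]] := ancestor nu.
have wu' : dle m w u by apply: dle_leq wu; lia.
have [xw|yw] := frontier_near lx ly lw uxy (up_trans uxu (up_sym upw)) nxy.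
  by left; exact: dle_trans wu'.
by right; exact: dle_trans wu'.
Qed.

(* Otherwise the two components above and the ball below would be the three
   paths of a fat theta between balls around p1 and q1. *)
Lemma unique_split_child_aligned n x1 y1 x2 y2 p1 q1 p2 q2 :
  lev x1 = n.+1 -> lev y1 = n.+1 -> lev x2 = n.+1 -> lev y2 = n.+1 ->
  lev p1 = n -> lev q1 = n ->
  adj p1 x1 -> adj q1 y1 -> adj p2 x2 -> adj q2 y2 ->
  dle D p1 p2 -> dle D q1 q2 ->
  up n.+1 x1 y1 -> up n.+1 x2 y2 -> ~ dle T2 x1 y1 -> ~ dle T2 x2 y2 ->
  up n.+1 x1 x2.
Proof.
move=> lx1 ly1 lx2 ly2 lp1 lq1 px1 qy1 px2 qy2 p12 q12 u1 u2 nd1 nd2.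
apply: contrapT => nu.
(* Points of both children up to level [n + 3 * K] are within [2 * D + 3 * K + 1] of [p1] or [q1]; a
   further [3 * K] catches the points of the third strand close to them. *)
pose r := 2 * D + 6 * K + 1.
pose A := nbhd [set p1] r; pose B := nbhd [set q1] r.
have cA : connected_set A by apply: connected_nbhd; exact: connected_set1.
have cB : connected_set B by apply: connected_nbhd; exact: connected_set1.
have inA m w : dle m p1 w -> m <= r -> A w.
  by move=> h mr; exists p1 => //; exact: dle_leq h.
have inB m w : dle m q1 w -> m <= r -> B w.
  by move=> h mr; exists q1 => //; exact: dle_leq h.
have far_AB : far (3 * K + 2) A B.
  move=> m a b [_ -> pa] [_ -> qb] ab; rewrite leqNgt; apply/negP => mN; apply: nd1.
  have h := dle_trans (dle_trans pa ab) (dle_sym qb).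
  have := dle_trans (dle_trans (dle_sym (dle1 px1)) h) (dle1 qy1).
  by apply: dle_leq; rewrite /split_gap /r /cluster_radius; lia.
pose C1 := up n.+1 x1; pose C2 := up n.+1 x2.
pose P3 : set G := [set z | lev z <= n].
have J1 : joins A B C1.
  exists x1, y1; split; last exact: conn_self.
    by apply: inA (dle1 px1) _; rewrite /r; lia.
  by apply: inB (dle1 qy1) _; rewrite /r; lia.
have J2 : joins A B C2.
  exists x2, y2; split; last exact: conn_self.
    by apply: inA (dle_trans p12 (dle1 px2)) _; rewrite /r; lia.
  by apply: inB (dle_trans q12 (dle1 qy2)) _; rewrite /r; lia.
have geo p : lev p = n -> conn P3 (basept p) p.
  by move=> lp; apply: conn_sub (geodesic_basept p) => z [+ _]; rewrite lp.
have J3 : joins A B P3.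
  exists p1, q1; split; [exact: inA (dle_refl 0 _) _|exact: inB (dle_refl 0 _) _|].
  apply: (conn_trans (conn_sym (geo _ lp1))).
  have -> : basept p1 = basept q1; last exact: geo.
  by rewrite (basept_dle (dle1 qy1)) (basept_dle (dle1 px1)) (up_basept u1).
have near C u : C = C1 \/ C = C2 -> C u -> lev u <= n + 3 * K ->
    dle (2 * D + 3 * K + 1) p1 u \/ dle (2 * D + 3 * K + 1) q1 u.
  have DT : D <= T2 by rewrite /split_gap; lia.
  move=> [] -> Cu lu; have {}lu : lev u <= n.+1 + 3 * K by lia.
    have nd : ~ dle D x1 y1 by move=> /(dle_leq DT).
    have [h|h] := near_frontier_point lx1 ly1 u1 nd Cu lu; [left|right].
      by apply: dle_leq (dle_trans (dle1 px1) h); lia.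
    by apply: dle_leq (dle_trans (dle1 qy1) h); lia.
  have nd : ~ dle D x2 y2 by move=> /(dle_leq DT).
  have [h|h] := near_frontier_point lx2 ly2 u2 nd Cu lu; [left|right].
    by apply: dle_leq (dle_trans p12 (dle_trans (dle1 px2) h)); lia.
  by apply: dle_leq (dle_trans q12 (dle_trans (dle1 qy2) h)); lia.
have nearAB C u : C = C1 \/ C = C2 -> C u -> lev u <= n + 3 * K -> (A `|` B) u.
  move=> CE Cu lu; have [h|h] := near C u CE Cu lu.
    by left; apply: inA h _; rewrite /r; lia.
  by right; apply: inB h _; rewrite /r; lia.
(* Above level [n + 3 * K], points closer than [3 * K] would share a component by [up_near]. *)
have N12 : near_only_in (A `|` B) (3 * K) C1 C2.
  move=> m u v Cu Cv uv mK.
  have nuv : ~ up n.+1 u v.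
    by move=> h; apply: nu; exact: up_trans (up_trans Cu h) (up_sym Cv).
  split.
    apply: (nearAB C1) => //; first by left.
    by rewrite leqNgt; apply/negP => h; apply: nuv; apply: up_near uv _; lia.
  apply: (nearAB C2) => //; first by right.
  rewrite leqNgt; apply/negP => h; apply: nuv; apply: up_sym.
  by apply: up_near (dle_sym uv) _; lia.
have N3 C : C = C1 \/ C = C2 -> near_only_in (A `|` B) (3 * K) C P3.
  move=> CE m u v Cu P3v uv mK.
  have lu : lev u <= n + 3 * K.
    have := lev_dle (dle_sym uv); rewrite /P3 /= in P3v; lia.
  split; first exact: nearAB CE Cu lu.
  have [h|h] := near C u CE Cu lu.
    by left; apply: inA (dle_trans h uv) _; rewrite /r; lia.
  by right; apply: inB (dle_trans h uv) _; rewrite /r; lia.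
by apply: noK; apply: (theta_fat_K4minus R K0 cA cB far_AB J1 J2 J3 N12); apply: N3;
  [left|right].
Qed.

(** The parents [p1] and [q1] are far apart in the frontier below, so [p2] and [q2] are each within
    [D] of one of them. They are not near the same one, being more than [2 * D] apart. Up to
    exchanging [x2] and [y2] this is the aligned case. *)
Lemma unique_split_child n x1 y1 x2 y2 :
  lev x1 = n.+1 -> lev y1 = n.+1 -> lev x2 = n.+1 -> lev y2 = n.+1 ->
  up n.+1 x1 y1 -> up n.+1 x2 y2 -> up n x1 x2 ->
  ~ dle T2 x1 y1 -> ~ dle T2 x2 y2 -> up n.+1 x1 x2.
Proof.
move=> lx1 ly1 lx2 ly2 u1 u2 u12 nd1 nd2.
have [p1 px1 lp1] := lev_pred lx1; have [q1 qy1 lq1] := lev_pred ly1.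
have [p2 px2 lp2] := lev_pred lx2; have [q2 qy2 lq2] := lev_pred ly2.
have parent_up p q x y : adj p x -> adj q y -> lev p = n -> lev q = n ->
    lev x = n.+1 -> lev y = n.+1 -> up n x y -> up n p q.
  move=> px qy lp lq lx ly xy.
  have px' : up n p x by apply: up_adj => //; lia.
  apply: (up_trans px'); apply: (up_trans xy); apply: up_sym.
  by apply: up_adj => //; lia.
have up1 : up n x1 y1 by apply: up_leq u1.
have up2 : up n x2 y2 by apply: up_leq u2.
have pq1 : up n p1 q1 by exact: parent_up px1 qy1 _ _ _ _ _.
have pp2 : up n p1 p2 by exact: parent_up px1 px2 _ _ _ _ _.
have pq2 : up n p1 q2.
  by apply: parent_up px1 qy2 _ _ _ _ _ => //; exact: up_trans up2.
have lift p q x y m : adj p x -> adj q y -> dle m p q -> dle (m + 2) x y.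
  move=> px qy pq; have := dle_trans (dle_sym (dle1 px)) (dle_trans pq (dle1 qy)).
  by apply: dle_leq; lia.
have n1 : ~ dle D p1 q1.
  move=> /(lift _ _ _ _ _ px1 qy1)/dle_leq h; apply: nd1; apply: h.
  by rewrite /split_gap; lia.
have n2 : ~ dle (2 * D) p2 q2.
  move=> /(lift _ _ _ _ _ px2 qy2)/dle_leq h; apply: nd2; apply: h.
  by rewrite /split_gap; lia.
have twoD p : dle D p p2 -> dle D p q2 -> False.
  by move=> h1 h2; apply: n2; apply: dle_leq (dle_trans (dle_sym h1) h2); lia.
have [h|h] := frontier_near lp1 lq1 lp2 pq1 pp2 n1;
  have [h'|h'] := frontier_near lp1 lq1 lq2 pq1 pq2 n1; try by case: (twoD _ h h').
  exact: unique_split_child_aligned lp1 lq1 px1 qy1 px2 qy2 h h' u1 u2 nd1 nd2.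
apply: up_trans (up_sym u2).
apply: (unique_split_child_aligned lx1 ly1 ly2 lx2 lp1 lq1 px1 qy1 qy2 px2 h' h) => //.
  exact: up_sym.
by move=> /dle_sym.
Qed.

Definition split u := exists x y,
  [/\ lev x = lev u, lev y = lev u, up (lev u) u x, up (lev u) u y & ~ dle T x y].

(** An unsplit frontier is one class; a split one falls into clusters recognised by the bound
    [2 * D]. Transitivity rests on [split_dichotomy]. *)
Definition eqv u v :=
  [/\ lev u = lev v, up (lev u) u v & split u -> dle (2 * D) u v].

Lemma split_up u v : lev u = lev v -> up (lev u) u v -> split u -> split v.
Proof.
move=> luv upuv [x [y [lx ly ux uy nxy]]]; exists x, y.
by rewrite -luv; split=> //; apply: up_trans (up_sym upuv) _.
Qed.

(** Each of [a], [b] is within [D] of one of two points [x], [y] more than [T] apart. If near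
    different ones, they would put [x] and [y] within [D + (T2 + 2) + D], which is [T]; so both are
    near the same one. *)
Lemma split_dichotomy u a b : split u -> lev a = lev u -> lev b = lev u ->
  up (lev u) u a -> up (lev u) u b -> dle (T2 + 2) a b -> dle (2 * D) a b.
Proof.
move=> [x [y [lx ly ux uy nxy]]] la lb ua ub ab; apply: contrapT => nab.
have uxy := up_trans (up_sym ux) uy.
have nD : ~ dle D x y.
  by move=> h; apply: nxy; apply: dle_leq h; rewrite /class_diameter; lia.
have near w : lev w = lev u -> up (lev u) u w -> dle D x w \/ dle D y w.
  by move=> lw uw; apply: frontier_near lx ly lw uxy (up_trans (up_sym ux) uw) nD.
have [xa|ya] := near a la ua.
  have [xb|yb] := near b lb ub.
    by apply: nab; apply: dle_leq (dle_trans (dle_sym xa) xb); lia.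
  apply: nxy; apply: dle_leq (dle_trans (dle_trans xa ab) (dle_sym yb)).
  by rewrite /class_diameter; lia.
have [xb|yb] := near b lb ub.
  apply: nxy; apply: dle_leq (dle_trans (dle_trans xb (dle_sym ab)) (dle_sym ya)).
  by rewrite /class_diameter; lia.
by apply: nab; apply: dle_leq (dle_trans (dle_sym ya) yb); lia.
Qed.

Lemma eqv_refl u : eqv u u.
Proof. by split=> // [|_]; [exact: up_refl|exact: dle_refl]. Qed.

Lemma eqv_sym u v : eqv u v -> eqv v u.
Proof.
case=> luv upuv duv; split; [exact: esym|by rewrite -luv; exact: up_sym|].
have upvu : up (lev v) v u by rewrite -luv; exact: up_sym.
by move=> /(split_up (esym luv) upvu)/duv/dle_sym.
Qed.

Lemma eqv_trans u v w : eqv u v -> eqv v w -> eqv u w.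
Proof.
move=> [luv upuv duv] [lvw upvw dvw].
have upuw : up (lev u) u w by apply: up_trans upuv _; rewrite luv.
split=> // [|su]; first by rewrite luv.
apply: (split_dichotomy su) => //; first by rewrite luv.
  exact: up_refl.
apply: dle_leq (dle_trans (duv su) (dvw (split_up luv upuv su))).
by rewrite /split_gap; lia.
Qed.

Lemma eqv_dle u v : eqv u v -> dle T u v.
Proof.
move=> [luv upuv duv]; have [/duv h|ns] := pselect (split u).
  by apply: dle_leq h; rewrite /class_diameter; lia.
apply: contrapT => nuv; apply: ns; exists u, v; split=> //.
exact: up_refl.
Qed.

Lemma eqv_not_split u v : lev u = lev v -> up (lev u) u v -> ~ split u -> eqv u v.
Proof. by move=> luv upuv ns; split. Qed.

Lemma eqv_near u v : lev u = lev v -> up (lev u) u v -> dle (T2 + 2) u v -> eqv u v.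
Proof.
move=> luv upuv duv; split=> // su; apply: (split_dichotomy su) => //.
exact: up_refl.
Qed.

Lemma eqv_adj u v : lev u = lev v -> adj u v -> eqv u v.
Proof.
move=> luv uv; apply: eqv_near => //; first by apply: up_adj => //; rewrite luv.
by apply: dle_leq (dle1 uv); lia.
Qed.

(** Equivalent vertices of a split frontier are within [2 * D], so their parents are within
    [2 * D + 2], which [eqv_near] accepts. *)
Lemma parent_eqv u v u' v' : adj u v -> adj u' v' -> lev u = (lev v).+1 ->
  lev u' = (lev v').+1 -> split u -> eqv u u' -> eqv v v'.
Proof.
move=> uv uv' luv luv' su [luu' upuu' duu'].
have lvv' : lev v = lev v' by lia.
apply: eqv_near => //.
  have upv : up (lev v) v u by apply: up_adj; rewrite 1?adj_sym //; lia.
  apply: (up_trans upv); apply: (@up_trans _ _ u').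
    by apply: up_leq upuu'; lia.
  by apply: up_adj => //; lia.
apply: dle_leq (dle_trans (dle_sym (dle1 uv)) (dle_trans (duu' su) (dle1 uv'))).
by rewrite /split_gap; lia.
Qed.

(** Boundary edges lead from the frontier one level down. In a split frontier two of the three upper
    ends are within [D], hence equivalent, and so are their parents. Otherwise all upper ends form
    one class, and the pigeonhole applies to the lower ends, which share a frontier. *)
Lemma small_cut_above x : small_cut eqv (up (lev x) x).
Proof.
move=> a1 b1 a2 b2 a3 b3 ab1 ab2 ab3 S1 S2 S3 nS1 nS2 nS3.
have bd a b : adj a b -> up (lev x) x a -> ~ up (lev x) x b ->
    lev a = lev x /\ lev x = (lev b).+1.
  move=> ab Sa nSb; have := conn_end Sa; rewrite /= => xa.
  have lb : lev b < lev x.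
    rewrite ltnNge; apply/negP => xb; apply: nSb; apply: (up_trans Sa).
    exact: up_adj.
  have := lev_adj ab; have := lev_adj ab; rewrite adj_sym in ab.
  by have := lev_adj ab; lia.
have [la1 lb1] := bd _ _ ab1 S1 nS1; have [la2 lb2] := bd _ _ ab2 S2 nS2.
have [la3 lb3] := bd _ _ ab3 S3 nS3.
have up_a a a' : up (lev x) x a -> up (lev x) x a' -> lev a = lev x -> up (lev a) a a'.
  by move=> Sa Sa' ->; exact: up_trans (up_sym Sa) Sa'.
have up_b a b a' b' : adj a b -> adj a' b' -> up (lev x) x a -> up (lev x) x a' ->
    lev a = lev x -> lev x = (lev b).+1 -> lev a' = lev x -> lev x = (lev b').+1 ->
    up (lev b) b b'.
  move=> ab ab' Sa Sa' la lb la' lb'.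
  have ba : up (lev b) b a by apply: up_adj; rewrite 1?adj_sym //; lia.
  apply: (up_trans ba); apply: (@up_trans _ _ a').
    by apply: up_leq (up_a _ _ Sa Sa' la); lia.
  by apply: up_adj => //; lia.
have DT : D <= T2 + 2 by rewrite /split_gap; lia.
have [sx|nsx] := pselect (split x).
  have coincide a b a' b' : adj a b -> adj a' b' -> up (lev x) x a -> up (lev x) x a' ->
      lev a = lev x -> lev x = (lev b).+1 -> lev a' = lev x -> lev x = (lev b').+1 ->
      dle D a a' -> eqv a a' /\ eqv b b'.
    move=> ab ab' Sa Sa' la lb la' lb' aa'.
    have E : eqv a a'.
      by apply: eqv_near; [rewrite la|exact: up_a|exact: dle_leq aa'].
    split=> //; apply: parent_eqv ab ab' _ _ _ E; [by lia|by lia|].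
    by apply: (split_up _ _ sx).
  have u12 := up_a _ _ S1 S2 la1; have u13 := up_a _ _ S1 S3 la1.
  rewrite la1 in u12 u13.
  case: (frontier_pigeonhole la1 la2 la3 u12 u13) => h.
  - by constructor 1; exact: coincide h.
  - by constructor 2; exact: coincide h.
  - by constructor 3; exact: coincide h.
have eqa a a' : up (lev x) x a -> up (lev x) x a' -> lev a = lev x ->
    lev a' = lev x -> eqv a a'.
  move=> Sa Sa' la la'; apply: eqv_not_split; [by rewrite la|exact: up_a|].
  move=> sa; apply: nsx; apply: split_up sa => //; rewrite la; exact: up_sym.
have u12 : up (lev b1) b1 b2 by exact: up_b ab1 ab2 _ _ _ _ _ _.
have u13 : up (lev b1) b1 b3 by exact: up_b ab1 ab3 _ _ _ _ _ _.
have u23 : up (lev b2) b2 b3 by exact: up_b ab2 ab3 _ _ _ _ _ _.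
have l12 : lev b2 = lev b1 by lia.
have l13 : lev b3 = lev b1 by lia.
case: (frontier_pigeonhole (erefl _) l12 l13 u12 u13) => /(dle_leq DT) h.
- by constructor 1; split; [exact: eqa|apply: eqv_near].
- by constructor 2; split; [exact: eqa|apply: eqv_near].
- by constructor 3; split; [exact: eqa|apply: eqv_near => //; rewrite l12].
Qed.

(* The class of x with the components above it attached to no other class. *)
Definition hanging x : set G := [set w | eqv w x \/
  [/\ lev x < lev w, up (lev x) x w & forall z v, up (lev x).+1 w z ->
    lev z = (lev x).+1 -> adj z v -> lev v = lev x -> eqv v x]].

(** A child attached to the class of [x] through [c] and to another class through [f] has a wide
    frontier: if [d] and [e] were close, [c] and [f] would be close enough to be equivalent. *)
Lemma child_gap x c d e f : adj c d -> adj e f -> eqv c x ->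
  lev d = (lev x).+1 -> up (lev x).+1 d e -> lev e = (lev x).+1 ->
  lev f = lev x -> ~ eqv f x -> ~ dle T2 d e.
Proof.
move=> cd ef cx ld de le lf nfx hde; apply: nfx.
have [lc uc _] := cx.
apply: eqv_sym; apply: (eqv_trans (eqv_sym cx)); apply: eqv_near; first by lia.
  apply: (@up_trans _ _ d); first by apply: up_adj => //; lia.
  apply: (@up_trans _ _ e); first by apply: up_leq de; lia.
  by apply: up_adj => //; lia.
by apply: dle_leq (dle_trans (dle1 cd) (dle_trans hde (dle1 ef))); lia.
Qed.

(** All boundary edges start in the class of [x]. Those going down end in one class by [parent_eqv].
    Those going up enter children attached to another class too; these have wide frontiers, so there
    is only one such child by [unique_split_child], and the upper ends are close. Of three edges,
    two go the same way. *)
Lemma small_cut_hanging x : split x -> small_cut eqv (hanging x).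
Proof.
move=> sx a1 b1 a2 b2 a3 b3 ab1 ab2 ab3 S1 S2 S3 nS1 nS2 nS3.
have bd a b : adj a b -> hanging x a -> ~ hanging x b -> eqv a x /\
    (lev x = (lev b).+1 \/ lev b = (lev x).+1 /\
      exists z v, [/\ up (lev x).+1 b z, lev z = (lev x).+1, adj z v,
                      lev v = lev x & ~ eqv v x]).
  move=> ab Sa nSb; have ba : adj b a by rewrite adj_sym.
  have l1 := lev_adj ab; have l2 := lev_adj ba.
  (* A vertex hanging above the class has no neighbour outside: one above the level of [x] is in the
     same child, and one at that level is equivalent to [x]. *)
  case: Sa => [ax|[la upa Ha]]; last first.
    have [lb|lb] := ltnP (lev x) (lev b).
      case: nSb; right; split=> //.
        by apply: up_trans upa _; apply: up_adj => //; exact: ltnW.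
      move=> z v bz; apply: Ha; apply: up_trans bz; exact: up_adj.
    case: nSb; left; apply: (Ha a b) => //; [exact: up_refl|by lia|by lia].
  have [lax upax _] := ax; split=> //.
  have [lba|lba] := eqVneq (lev b) (lev a).
    case: nSb; left; apply: eqv_trans ax; exact: eqv_adj.
  have [|lab] := ltnP (lev b) (lev a); [by left; lia|right].
  split; first by lia.
  apply: contrapT => nz; apply: nSb; right; split; [by lia| |].
    by apply: up_trans (up_sym _) (up_adj _ _ ab); rewrite -?lax //; lia.
  move=> z v bz lz zv lv; apply: contrapT => nvx; apply: nz.
  by exists z, v.
have below a b a' b' : adj a b -> adj a' b' -> eqv a x -> eqv a' x ->
    lev x = (lev b).+1 -> lev x = (lev b').+1 -> eqv a a' /\ eqv b b'.
  move=> ab ab' ax ax' lb lb'; have aa' := eqv_trans ax (eqv_sym ax').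
  split=> //; have [la ua _] := eqv_sym ax.
  apply: parent_eqv ab ab' _ _ _ aa'; [by lia|by case: ax'; lia|].
  exact: split_up sx.
have above a b a' b' : adj a b -> adj a' b' -> eqv a x -> eqv a' x ->
    lev b = (lev x).+1 /\ (exists z v, [/\ up (lev x).+1 b z, lev z = (lev x).+1,
      adj z v, lev v = lev x & ~ eqv v x]) ->
    lev b' = (lev x).+1 /\ (exists z v, [/\ up (lev x).+1 b' z, lev z = (lev x).+1,
      adj z v, lev v = lev x & ~ eqv v x]) -> eqv a a' /\ eqv b b'.
  move=> ab ab' ax ax' [lb [z [v [bz lz zv lv nvx]]]].
  move=> [lb' [z' [v' [bz' lz' zv' lv' nvx']]]].
  have aa' := eqv_trans ax (eqv_sym ax'); split=> //.
  have g := child_gap ab zv ax lb bz lz lv nvx.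
  have g' := child_gap ab' zv' ax' lb' bz' lz' lv' nvx'.
  have [la ua _] := ax; have [la' ua' da'] := aa'.
  have ubb' : up (lev x) b b'.
    apply: (@up_trans _ _ a); first by apply: up_adj; rewrite 1?adj_sym //; lia.
    apply: (@up_trans _ _ a'); first by rewrite -la.
    by apply: up_adj => //; lia.
  have := unique_split_child lb lz lb' lz' bz bz' ubb' g g' => upbb'.
  apply: eqv_near; rewrite ?lb ?lb' //.
  have sa : split a.
    by apply: (split_up _ _ sx) => //; rewrite -?la //; exact: up_sym.
  apply: dle_leq (dle_trans (dle_sym (dle1 ab)) (dle_trans (da' sa) (dle1 ab'))).
  by rewrite /split_gap; lia.
have [x1 [l1|l1]] := bd _ _ ab1 S1 nS1; have [x2 [l2|l2]] := bd _ _ ab2 S2 nS2;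
have [x3 [l3|l3]] := bd _ _ ab3 S3 nS3.
- by constructor 1; exact: below.
- by constructor 1; exact: below.
- by constructor 2; exact: below.
- by constructor 3; exact: above.
- by constructor 3; exact: below.
- by constructor 2; exact: above.
- by constructor 1; exact: above.
- by constructor 1; exact: above.
Qed.

Lemma small_cut_setC E (S : set G) : small_cut E S -> small_cut E (~` S).
Proof.
move=> HS a1 b1 a2 b2 a3 b3 ab1 ab2 ab3 S1 S2 S3 nS1 nS2 nS3.
rewrite adj_sym in ab1; rewrite adj_sym in ab2; rewrite adj_sym in ab3.
have [] := HS _ _ _ _ _ _ ab1 ab2 ab3; try exact: contrapT; try by [];
  move=> [? ?]; [constructor 1|constructor 2|constructor 3]; by [].
Qed.

Definition saturated (S : set G) := forall u v, eqv u v -> S u -> S v.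

Lemma saturated_setC S : saturated S -> saturated (~` S).
Proof. by move=> HS u v /eqv_sym/HS; apply: contra_not. Qed.

Lemma saturated_above x : saturated (up (lev x) x).
Proof.
move=> u v [_ uv _] xu; apply: (up_trans xu); apply: up_leq uv.
exact: conn_end xu.
Qed.

Lemma saturated_hanging x : saturated (hanging x).
Proof.
move=> u v uv [ux|[xu upu Hu]]; first by left; apply: eqv_trans (eqv_sym uv) ux.
have [luv upuv _] := uv; right; split; first by rewrite -luv.
  by apply: up_trans upu _; apply: up_leq upuv; exact: ltnW.
by move=> z w vz; apply: Hu; apply: up_trans vz; exact: up_leq upuv.
Qed.

(** Let [a] be the vertex of higher or equal level. Either the component above it omits [b], or both
    lie in one frontier, necessarily split, and [hanging a] separates them. Complements settle the
    other order. *)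
Lemma separating_cut x y : ~ eqv x y ->
  exists S : set G, [/\ saturated S, small_cut eqv S, S x & ~ S y].
Proof.
move=> nxy.
have sep a b : lev b <= lev a -> ~ eqv a b ->
    exists S : set G, [/\ saturated S, small_cut eqv S, S a & ~ S b].
  move=> lba nab; have [uab|nuab] := pselect (up (lev a) a b); last first.
    exists (up (lev a) a); split=> //; [exact: saturated_above|exact: small_cut_above|].
    exact: up_refl.
  have lab : lev a = lev b by have := conn_end uab; rewrite /=; lia.
  exists (hanging a); split; [exact: saturated_hanging| |by left; exact: eqv_refl|].
    by apply: small_cut_hanging; apply: contrapT => ns; apply/nab/eqv_not_split.
  by case=> [/eqv_sym//|[]]; rewrite lab ltnn.
have [lxy|lyx] := leqP (lev y) (lev x); first exact: sep.
have [||S [sS cS Sy nSx]] := sep y x; [exact: ltnW|by move=> /eqv_sym|].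
exists (~` S); split; [exact: saturated_setC|exact: small_cut_setC|by []|].
by move=> /(_ Sy).
Qed.

End Frontiers.

(** * Two-edge cuts exclude a K4- minor *)

Section Cuts.
Local Open Scope classical_set_scope.
Variable G : graph.
Implicit Types (u v w x y z : G) (U W L X Y Z : set G).

(** A walk from [t3] first hits a path between [t1] and [t2] in [x], which splits that path into two
    legs. *)
Lemma tripod U t1 t2 t3 : connected_set U -> U t1 -> U t2 -> U t3 ->
  exists x L1 L2 L3, [/\ [/\ L1 `<=` U, L2 `<=` U & L3 `<=` U],
    [/\ conn L1 x t1, conn L2 x t2 & conn L3 x t3] &
    [/\ L1 `&` L2 `<=` [set x], L1 `&` L3 `<=` [set x] & L2 `&` L3 `<=` [set x]]].
Proof.
move=> /connected_setP[_ cU] U1 U2 U3.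
have /connP[p0 [+ + p0U]] := cU _ _ U1 U2.
case/shortenP => p tp up sp lp.
have pU : [set` t1 :: p] `<=` U.
  move=> w; rewrite /= inE => /predU1P[->//|/sp wp]; apply: p0U => /=.
  by rewrite inE wp orbT.
have pt1 : [set` t1 :: p] t1 by rewrite /= mem_head.
have [x [L [LU Lx LW]]] := conn_first_hit (cU _ _ U3 U1) pt1.
have : (L `&` [set` t1 :: p]) x by rewrite LW.
move=> [_ /= /splitPl px]; case: px tp up lp LW pU {sp pt1} => p1 p2 lx.
rewrite cat_path last_cat lx => /andP[tp1 xp2] up lp LW pU.
have W1 : [set` t1 :: p1] `<=` [set` t1 :: p1 ++ p2].
  by move=> w /= h; rewrite -cat_cons mem_cat [_ \in t1 :: p1]h.
have W2 : [set` x :: p2] `<=` [set` t1 :: p1 ++ p2].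
  move=> w /=; rewrite inE => /predU1P[->|h]; rewrite -cat_cons mem_cat ?h ?orbT //.
  by rewrite -lx mem_last.
exists x, [set` t1 :: p1], [set` x :: p2], L; split; split.
- by apply: subset_trans pU.
- by apply: subset_trans pU.
- by [].
- by apply: conn_sym; apply/connP; exists p1; split.
- by apply/connP; exists p2; split.
- exact: conn_sym.
- move=> w [/= w1]; rewrite inE => /predU1P[->//|w2].
  move: up; rewrite -cat_cons cat_uniq => /and3P[_ /hasPn/(_ w w2)].
  by rewrite [_ \in _]w1.
- by rewrite -LW => w [/W1 ? ?]; split.
- by rewrite -LW => w [/W2 ? ?]; split.
Qed.

(** Tripods in [U] and [W] extend the [Zi] to three routes from [x] to [y] sharing no other vertex.
    Each has an edge leaving [S]; two of these coincide, so they are the edge [xy]. Only the third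
    route may use that edge: the others split at [c1] and [c2] into a part avoiding [W] and a part
    avoiding [U]. *)
Lemma no_theta U W t1 t2 t3 s1 s2 s3 c1 c2 X1 Y1 X2 Y2 Z1 Z2 Z3 :
  (forall x y, x <> y -> exists S : set G, [/\ small_cut eq S, S x & ~ S y]) ->
  connected_set U -> connected_set W -> U `&` W = set0 ->
  Z1 `&` U = [set t1] -> Z2 `&` U = [set t2] -> Z3 `&` U = [set t3] ->
  Z1 `&` W = [set s1] -> Z2 `&` W = [set s2] -> Z3 `&` W = [set s3] ->
  Z1 `&` Z2 `<=` U `|` W -> Z1 `&` Z3 `<=` U `|` W -> Z2 `&` Z3 `<=` U `|` W ->
  conn X1 t1 c1 -> conn Y1 c1 s1 -> conn X2 t2 c2 -> conn Y2 c2 s2 ->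
  conn Z3 t3 s3 -> X1 `<=` Z1 -> Y1 `<=` Z1 -> X2 `<=` Z2 -> Y2 `<=` Z2 ->
  X1 `&` W = set0 -> Y1 `&` U = set0 -> X2 `&` W = set0 -> Y2 `&` U = set0 -> False.
Proof.
move=> cut cU cW UW ZU1 ZU2 ZU3 ZW1 ZW2 ZW3 Z12 Z13 Z23 tc1 cs1 tc2 cs2 ts3.
move=> XZ1 YZ1 XZ2 YZ2 XW1 YU1 XW2 YU2.
have endU Z t V : Z `&` V = [set t] -> V t /\ forall w, Z w -> V w -> w = t.
  move=> E; split; first by have : [set t] t by []; rewrite -E => -[].
  by move=> w Zw Vw; have : [set t] w by rewrite -E; split.
have [U1 u1] := endU _ _ _ ZU1; have [U2 u2] := endU _ _ _ ZU2.
have [U3 u3] := endU _ _ _ ZU3; have [W1 w1] := endU _ _ _ ZW1.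
have [W2 w2] := endU _ _ _ ZW2; have [W3 w3] := endU _ _ _ ZW3.
have disj A B w : A `&` B = set0 -> A w -> B w -> False.
  by move=> E Aw Bw; have : set0 w by rewrite -E.
have [x [L1 [L2 [L3 [[LU1 LU2 LU3] [Lt1 Lt2 Lt3] [L12 L13 L23]]]]]] :=
  tripod cU U1 U2 U3.
have [y [M1 [M2 [M3 [[MW1 MW2 MW3] [Ms1 Ms2 Ms3] [M12 M13 M23]]]]]] :=
  tripod cW W1 W2 W3.
have Ux : U x by apply: LU1; exact: conn_start Lt1.
have Wy : W y by apply: MW1; exact: conn_start Ms1.
have xy : x <> y by move=> E; apply: (disj _ _ x UW) => //; rewrite E.
have [S [Scut Sx nSy]] := cut x y xy.
have common Li Zi Mi Lj Zj Mj ti si tj sj w :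
    Li `<=` U -> Mi `<=` W -> Lj `<=` U -> Mj `<=` W ->
    Li ti -> Mi si -> Lj tj -> Mj sj ->
    (forall w, Zi w -> U w -> w = ti) -> (forall w, Zi w -> W w -> w = si) ->
    (forall w, Zj w -> U w -> w = tj) -> (forall w, Zj w -> W w -> w = sj) ->
    Zi `&` Zj `<=` U `|` W -> Li `&` Lj `<=` [set x] -> Mi `&` Mj `<=` [set y] ->
    (Li `|` Zi `|` Mi) w -> (Lj `|` Zj `|` Mj) w -> w = x \/ w = y.
  move=> LiU MiW LjU MjW Lti Msi Ltj Msj ui wi uj wj Zij Lij Mij Ri Rj.
  have side L Z M t s : L `<=` U -> M `<=` W -> L t -> M s ->
      (forall w, Z w -> U w -> w = t) -> (forall w, Z w -> W w -> w = s) ->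
      (L `|` Z `|` M) w ->
      [/\ U w -> L w, W w -> M w & ~ U w -> ~ W w -> Z w].
    move=> LU MW Lt Ms tw sw [[Lw|Zw]|Mw]; split=> //.
    - by move=> Wv; case: (disj _ _ w UW) => //; exact: LU.
    - by move=> nU; case: nU; exact: LU.
    - by move=> Uw; rewrite (tw w).
    - by move=> Ww; rewrite (sw w).
    - by move=> Uw; case: (disj _ _ w UW) => //; exact: MW.
    - by move=> _ nW; case: nW; exact: MW.
  have [UL WM nZ] := side _ _ _ _ _ LiU MiW Lti Msi ui wi Ri.
  have [UL' WM' nZ'] := side _ _ _ _ _ LjU MjW Ltj Msj uj wj Rj.
  have [Uw|nU] := pselect (U w); first by left; apply: Lij; split; auto.
  have [Ww|nW] := pselect (W w); first by right; apply: Mij; split; auto.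
  by case: (Zij w) => //; split; auto.
have cross L X Y Z M t s c : L `<=` U -> M `<=` W -> X `<=` Z -> Y `<=` Z ->
    conn L x t -> conn M y s -> conn X t c -> conn Y c s ->
    X `&` W = set0 -> Y `&` U = set0 ->
    exists a b, [/\ (L `|` Z `|` M) a, (L `|` Z `|` M) b, adj a b & [/\ S a, ~ S b &
      ~ (a = x /\ b = y)]].
  move=> LU MW XZ YZ Lt Ms tc cs XW YU.
  (* The crossing edge is sought on the side of [c] where it cannot be [xy]: the part after [c]
     misses [x], the part before misses [y]. *)
  have [Sc|nSc] := pselect (S c).
    have cy : conn (Y `|` M) c y.
      apply: (@conn_trans _ _ _ s); first by apply: conn_sub cs => w; left.
      by apply: conn_sub (conn_sym Ms) => w; right.
    have [a [b [Ya Yb ab Sa nSb]]] := conn_cross cy Sc nSy.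
    exists a, b; split=> //.
    - by case: Ya => [/YZ|]; [left; right|right].
    - by case: Yb => [/YZ|]; [left; right|right].
    split=> // -[ax _]; rewrite ax in Ya; case: Ya => [Yx|/MW Wx].
      exact: disj YU Yx Ux.
    exact: disj UW Ux Wx.
  have xc : conn (L `|` X) x c.
    apply: (@conn_trans _ _ _ t); first by apply: conn_sub Lt => w; left.
    by apply: conn_sub tc => w; right.
  have [a [b [Xa Xb ab Sa nSb]]] := conn_cross xc Sx nSc.
  exists a, b; split=> //.
  - by case: Xa => [|/XZ]; [left; left|left; right].
  - by case: Xb => [|/XZ]; [left; left|left; right].
  split=> // -[_ bE]; rewrite bE in Xb; case: Xb => [/LU Uy|Xy].
    exact: disj UW Uy Wy.
  exact: disj XW Xy Wy.
have [a1 [b1 [a1R b1R ab1 [Sa1 Sb1 n1]]]] :=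
  cross _ _ _ _ _ _ _ _ LU1 MW1 XZ1 YZ1 Lt1 Ms1 tc1 cs1 XW1 YU1.
have [a2 [b2 [a2R b2R ab2 [Sa2 Sb2 n2]]]] :=
  cross _ _ _ _ _ _ _ _ LU2 MW2 XZ2 YZ2 Lt2 Ms2 tc2 cs2 XW2 YU2.
have xy3 : conn (L3 `|` Z3 `|` M3) x y.
  apply: (@conn_trans _ _ _ t3); first by apply: conn_sub Lt3 => w; left; left.
  apply: (@conn_trans _ _ _ s3); first by apply: conn_sub ts3 => w; left; right.
  by apply: conn_sub (conn_sym Ms3) => w; right.
have [a3 [b3 [a3R b3R ab3 Sa3 Sb3]]] := conn_cross xy3 Sx nSy.
have C12 w := common L1 Z1 M1 L2 Z2 M2 t1 s1 t2 s2 w LU1 MW1 LU2 MW2 (conn_end Lt1)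
  (conn_end Ms1) (conn_end Lt2) (conn_end Ms2) u1 w1 u2 w2 Z12 L12 M12.
have C13 w := common L1 Z1 M1 L3 Z3 M3 t1 s1 t3 s3 w LU1 MW1 LU3 MW3 (conn_end Lt1)
  (conn_end Ms1) (conn_end Lt3) (conn_end Ms3) u1 w1 u3 w3 Z13 L13 M13.
have C23 w := common L2 Z2 M2 L3 Z3 M3 t2 s2 t3 s3 w LU2 MW2 LU3 MW3 (conn_end Lt2)
  (conn_end Ms2) (conn_end Lt3) (conn_end Ms3) u2 w2 u3 w3 Z23 L23 M23.
have ends a b : a = x \/ a = y -> b = x \/ b = y -> S a -> ~ S b -> a = x /\ b = y.
  by move=> [->|->] [->|->].
case: (Scut _ _ _ _ _ _ ab1 ab2 ab3 Sa1 Sa2 Sa3 Sb1 Sb2 Sb3) => -[aE bE].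
- by apply: n1; apply: ends => //; [apply: C12; rewrite // aE|apply: C12; rewrite // bE].
- by apply: n1; apply: ends => //; [apply: C13; rewrite // aE|apply: C13; rewrite // bE].
- by apply: n2; apply: ends => //; [apply: C23; rewrite // aE|apply: C23; rewrite // bE].
Qed.

Lemma set_path_mem U W (p : seq G) w : set_path U W p -> w \in p ->
  [\/ U w, W w | w \in inner p].
Proof.
case: p => //= x q [xq _ pU pW].
have Ux : U x by have : [set x] x by []; rewrite -pU => -[].
have Wl : W (last x q) by have : [set last x q] (last x q) by []; rewrite -pW => -[].
rewrite lastI mem_rcons inE => /predU1P[->|]; first by constructor 2.
case: q Wl xq pU pW => // y q _ _ _ _ /=.
by rewrite inE => /predU1P[->|]; [constructor 1|constructor 3].
Qed.

(** The degree-three branch sets [V i1] and [V i2] are joined by routes through [V i0] and [V i3]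
    and by the path of the edge between them. *)
Lemma no_K4minus_minor :
  (forall x y, x <> y -> exists S : set G, [/\ small_cut eq S, S x & ~ S y]) ->
  ~ minor K4minus G.
Proof.
move=> cut [V [E [cV dV pE iE EV]]].
pose i0 : K4minus := Ordinal (isT : 0 < 4).
pose i1 : K4minus := Ordinal (isT : 1 < 4).
pose i2 : K4minus := Ordinal (isT : 2 < 4).
pose i3 : K4minus := Ordinal (isT : 3 < 4).
have setI0 (A B : set G) w : A `&` B = set0 -> A w -> B w -> False.
  by move=> AB Aw Bw; have : set0 w by rewrite -AB.
have route j : adj i1 j -> adj i2 j -> exists t s c,
  [/\ conn [set` E i1 j] t c, conn (V j `|` [set` E i2 j]) c s,
      ([set` E i1 j] `|` V j `|` [set` E i2 j]) `&` V i1 = [set t] &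
      ([set` E i1 j] `|` V j `|` [set` E i2 j]) `&` V i2 = [set s]].
  move=> a1j a2j.
  have [j1 j2] : j <> i1 /\ j <> i2.
    by split=> E0; [move: a1j|move: a2j]; rewrite E0 adj_irr.
  have [t [c [t1 cj tc tU _]]] := set_path_ends (pE _ _ a1j).1.
  have [s [d [s2 dj sd sW _]]] := set_path_ends (pE _ _ a2j).1.
  exists t, s, c; split=> //.
  - have /connected_setP[_ /(_ c d cj dj) cd] := cV j.
    apply: (@conn_trans _ _ _ d); first by apply: conn_sub cd => w; left.
    by apply: conn_sub (conn_sym sd) => w; right.
  - by rewrite !setIUl tU (dV _ _ j1) (EV _ _ _ a2j) ?setU0 //; apply: nesym.
  - by rewrite !setIUl sW (dV _ _ j2) (EV _ _ _ a1j) ?set0U //; apply: nesym.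
have EVn (x y z : K4minus) w : adj x y -> z <> x -> z <> y -> w \in E x y ->
    V z w -> False.
  by move=> xy zx zy; exact: (@setI0 _ _ w (EV x y z xy zx zy)).
have VVn (x y : K4minus) w : x <> y -> V x w -> V y w -> False.
  by move=> xy; exact: (@setI0 _ _ w (dV x y xy)).
(* Paths of different edges meet only in ends, and the end in [V j] is ruled out because [j] is not
   on the second edge. *)
have meet (a j z w : K4minus) u : adj a j -> adj z w -> j <> z -> j <> w ->
    u \in E a j -> u \in E z w -> V a u.
  move=> aj zw jz jw ua uz; have [//|Vj|ui] := set_path_mem (pE _ _ aj).1 ua.
    by case: (EVn z w j u).
  case: (@setI0 [set` inner (E a j)] [set` E z w] u) => //; apply: iE => // E0.
  have : [set a; j] j by right.
  by rewrite E0 => -[].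
have [t1 [s1 [c1 [X1 Y1 U1 W1]]]] := route i0 isT isT.
have [t2 [s2 [c2 [X2 Y2 U2 W2]]]] := route i3 isT isT.
have [t3 [s3 [T3 S3 ts3 U3 W3]]] := set_path_ends (pE i1 i2 isT).1.
apply: (no_theta cut (cV i1) (cV i2) (dV i1 i2 _) U1 U2 U3 W1 W2 W3 _ _ _
  X1 Y1 X2 Y2 ts3) => //.
- move=> w [[[E1|V1]|E1] [[E2|V2]|E2]].
  + by left; apply: meet E1 E2.
  + by case: (EVn i1 i0 i3 w).
  + by left; apply: meet E1 E2.
  + by case: (EVn i1 i3 i0 w).
  + by case: (VVn i0 i3 w).
  + by case: (EVn i2 i3 i0 w).
  + by right; apply: meet E1 E2.
  + by case: (EVn i2 i0 i3 w).
  + by right; apply: meet E1 E2.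
- move=> w [[[E1|V1]|E1] E2].
  + by left; apply: meet E1 E2.
  + by case: (EVn i1 i2 i0 w).
  + by right; apply: meet E1 E2.
- move=> w [[[E1|V1]|E1] E2].
  + by left; apply: meet E1 E2.
  + by case: (EVn i1 i2 i3 w).
  + by right; apply: meet E1 E2.
- by move=> w; left; left.
- by move=> w [|]; [left; right|right].
- by move=> w; left; left.
- by move=> w [|]; [left; right|right].
- exact: EV.
- by rewrite setIUl (dV i0 i1) // (EV i2 i0 i1) // setU0.
- exact: EV.
- by rewrite setIUl (dV i3 i1) // (EV i2 i3 i1) // setU0.
Qed.

End Cuts.

(** * Distances and cuts in a quotient by classes of bounded diameter *)

Section Dist.
Variables (R : realType) (G : graph).
Implicit Types (u v : G).

Lemma dist_dle n u v : dle n u v -> (dist R u v <= n%:R%:E)%E.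
Proof.
move=> /dleP[p [up lp pn]]; apply: (@le_trans _ _ (size p)%:R%:E).
  by apply: ereal_inf_lbound; exists p => //=; rewrite up lp eqxx.
by rewrite lee_fin ler_nat.
Qed.

Lemma dist_cases u v : (exists2 n, dle n u v & dist R u v = n%:R%:E) \/
  dist R u v = +oo%E /\ forall n, ~ dle n u v.
Proof.
have [ex|nex] := pselect (exists n, `[< dle n u v >]).
  left; case: (ex_minnP ex) => n /asboolP nuv minn; exists n => //.
  apply/eqP; rewrite eq_le dist_dle //=; apply: le_ereal_inf_tmp.
  move=> _ [p /= /andP[up /eqP lp] <-]; rewrite lee_fin ler_nat.
  by apply: minn; apply/asboolP/dleP; exists p.
right; have nuv n : ~ dle n u v by move=> h; apply: nex; exists n; exact/asboolP.
split=> //; rewrite /dist -ereal_inf0; congr ereal_inf.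
apply/seteqP; split=> // _ [p /= /andP[up /eqP lp] _].
by apply: (nuv (size p)); apply/dleP; exists p.
Qed.

End Dist.

Section QuotientGraph.
Local Open Scope classical_set_scope.
Local Open Scope quotient_scope.
Variables (G : graph) (e : equiv_rel G).
Implicit Types (u v : G).

Definition quotient_adj : rel {eq_quot e} := fun a b =>
  (a != b) && `[< exists u v, [/\ adj u v, a = \pi u & b = \pi v] >].

Lemma quotient_sym : symmetric quotient_adj.
Proof.
have H a b : quotient_adj a b -> quotient_adj b a.
  rewrite /quotient_adj eq_sym => /andP[-> /asboolP[u [v [uv -> ->]]]] /=.
  by apply/asboolP; exists v, u; rewrite adj_sym.
by move=> a b; apply/idP/idP; exact: H.
Qed.

Lemma quotient_irr : irreflexive quotient_adj.
Proof. by move=> a; rewrite /quotient_adj eqxx. Qed.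

Definition quotient_graph : graph := Graph quotient_sym quotient_irr.

Definition quotient_map u : quotient_graph := \pi_{eq_quot e} u.
Local Notation phi := quotient_map.

Lemma quotient_mapP u v : phi u = phi v <-> e u v.
Proof. by split=> [/eqmodP|h]; last exact/eqmodP. Qed.

Lemma quotient_map_surj (h : quotient_graph) : exists u, phi u = h.
Proof. by exists (repr h); exact: reprK. Qed.

Lemma quotient_adjP (a b : quotient_graph) : adj a b <->
  a <> b /\ exists u v, [/\ adj u v, a = phi u & b = phi v].
Proof.
split=> [/andP[/eqP ? /asboolP] //|[/eqP ab h]].
by apply/andP; split=> //; apply/asboolP.
Qed.

Lemma dle_quotient_map n u v : dle n u v -> dle n (phi u) (phi v).
Proof.
elim=> {n u v} [n u|n u v w uv _ IH]; first exact: dle_refl.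
have [->|ne] := pselect (phi u = phi v); first exact: dle_leq IH.
by apply: dle_step IH; apply/quotient_adjP; split=> //; exists u, v.
Qed.

(** Each quotient edge lifts to a move of at most [T] inside a class followed by an edge; a final
    move of at most [T] reaches [v]. *)
Lemma dle_quotient T n u v : (forall x y, e x y -> dle T x y) ->
  dle n (phi u) (phi v) -> dle (T + n * T.+1) u v.
Proof.
move=> eT; move Ea : (phi u) => a; move Eb : (phi v) => b ab.
elim: ab u v Ea Eb => {n a b} [n a|n a b c ab _ IH] u v Ea Eb.
  by apply: dle_leq (leq_addr _ _) _; apply: eT; apply/quotient_mapP; rewrite Ea.
have [_ [x [y [xy ax yb]]]] := (quotient_adjP _ _).1 ab.
have ux : dle T u x by apply: eT; apply/quotient_mapP; rewrite Ea.
have := dle_trans ux (dle_trans (dle1 xy) (IH y v (esym yb) Eb)).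
by apply: dle_leq; rewrite mulSn; lia.
Qed.

(** Saturation makes membership in the image independent of the representative, so boundary edges
    lift to boundary edges of [S]. *)
Lemma quotient_small_cut (S : set G) : (forall u v, e u v -> S u -> S v) ->
  small_cut (fun u v => e u v) S -> small_cut eq (phi @` S).
Proof.
move=> sat cut.
have inS u : (phi @` S) (phi u) <-> S u.
  by split=> [[x Sx /quotient_mapP xu]|]; [exact: sat Sx|exists u].
move=> a1 b1 a2 b2 a3 b3 /quotient_adjP[_ [u1 [v1 [uv1 -> ->]]]].
move=> /quotient_adjP[_ [u2 [v2 [uv2 -> ->]]]] /quotient_adjP[_ [u3 [v3 [uv3 -> ->]]]].
rewrite !inS => S1 S2 S3 n1 n2 n3.
case: (cut _ _ _ _ _ _ uv1 uv2 uv3) => // -[/quotient_mapP-> /quotient_mapP->];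
  by [constructor 1|constructor 2|constructor 3].
Qed.

Lemma quotient_quasi_isometry (R : realType) T :
  (forall u v, e u v -> dle T u v) ->
  quasi_isometry (T.+1%:R : R) (T%:R : R) phi.
Proof.
move=> eT; split; first by rewrite ler1n.
- by rewrite ler0n.
- move=> u v; apply/andP; split.
    have [[m uvm ->]|[-> _]] := dist_cases R (phi u) (phi v); last by rewrite leey.
    have := dist_dle R (dle_quotient eT uvm).
    have [[n _ ->]|[-> //]] := dist_cases R u v.
    rewrite -EFinM -EFinB !lee_fin !ler_nat => nm.
    rewrite lerBlDr ler_pdivrMl ?ltr0n // -natrD -natrM ler_nat; nia.
  have [[n /dle_quotient_map/(dist_dle R) h ->]|[-> _]] := dist_cases R u v.
    apply: le_trans h _; rewrite -EFinM -EFinD lee_fin -natrM -natrD ler_nat; nia.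
  by rewrite mulry gtr0_sg ?ltr0n // mul1e addye // leey.
move=> h; have [u <-] := quotient_map_surj h; exists u.
by apply: le_trans (dist_dle R (dle_refl 0 _)) _; rewrite lee_fin ler0n.
Qed.

End QuotientGraph.

Local Open Scope ring_scope.

Theorem theorem3 (R : realType) :
  exists f : nat -> nat * nat,
    forall (K : nat) (G : graph),
      ~ fat_minor R K K4minus G ->
      exists H : graph,
        quasi_isometric ((f K).1%:R : R) ((f K).2%:R : R) G H /\
        ~ minor K4minus H.
Proof.
exists (fun K => ((class_diameter K.+1).+1, class_diameter K.+1)) => K G noK.
(* The fat theta argument needs positive fatness, so it is run with [K.+1]; a [K.+1]-fat model is
   also [K]-fat. *)
have {}noK : ~ fat_minor R K.+1 K4minus G.
  move=> [V [E [VE [f1 f2 f3]]]]; apply: noK; exists V, E; split=> //.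
  have le : (K%:R%:E <= K.+1%:R%:E :> \bar R)%E by rewrite lee_fin ler_nat.
  by split=> *; apply: (le_trans le); [exact: f1|exact: f2|exact: f3].
pose r (u v : G) := `[< eqv K.+1 u v >].
have r_refl : reflexive r by move=> u; apply/asboolP; exact: eqv_refl.
have r_sym : symmetric r.
  by move=> u v; apply/asboolP/asboolP; exact: eqv_sym.
have r_trans : transitive r.
  move=> v u w /asboolP uv /asboolP vw; apply/asboolP.
  exact: (eqv_trans _ noK) uv vw.
pose e := EquivRel r r_refl r_sym r_trans.
exists (quotient_graph e); split.
  exists (quotient_map e); apply: quotient_quasi_isometry => u v /asboolP.
  exact: eqv_dle.
apply: no_K4minus_minor => x y.
have [u <-] := quotient_map_surj x; have [v <-] := quotient_map_surj y => nuv.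
have [|S [sS cS Su nSv]] := @separating_cut R G K.+1 isT noK u v.
  by move=> uv; apply/nuv/quotient_mapP/asboolP.
have sat a b : e a b -> S a -> S b by move=> /asboolP; exact: sS.
exists (quotient_map e @` S)%classic; split; last first.
- by move=> [w Sw /quotient_mapP wv]; apply: nSv; exact: sat wv Sw.
- by exists u.
apply: quotient_small_cut => // a1 b1 a2 b2 a3 b3 h1 h2 h3 s1 s2 s3 n1 n2 n3.
by case: (cS _ _ _ _ _ _ h1 h2 h3 s1 s2 s3 n1 n2 n3) => -[ha hb];
  [constructor 1|constructor 2|constructor 3]; split; exact/asboolP.
Qed.
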